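(* Let $A$ be a physical system with Hamiltonian $H^A$ and Gibbs state $\gamma^A$, and let $\psi^A$ be a pure state on $A$. Then, with $\mathfrak{F}$ denoting closed thermal operations assisted by sublinear athermality resources, $$\mathrm{Cost}_\mathfrak{F}(\psi^A,\gamma^A)=D(\psi^A\|\gamma^A),$$ where $D(\rho\|\gamma)=\mathrm{Tr}[\rho\log\rho]-\mathrm{Tr}[\rho\log\gamma]$ is the Umegaki relative entropy.
   Context: Systems are finite dimensional with positive semidefinite Hamiltonians; composites of non-interacting systems have additive Hamiltonians $H^{XY}=H^X\otimes I+I\otimes H^Y$; $A^n$ is $n$ copies of $A$. For fixed $\beta>0$ the Gibbs state is $\gamma^X=e^{-\beta H^X}/\mathrm{Tr}[e^{-\beta H^X}]$, with $\gamma^{A^n}=(\gamma^A)^{\otimes n}$. A thermal operation is a channel obtainable by composing: appending systems in their Gibbs states, unitaries on a composite system commuting with its total Hamiltonian, and tracing out subsystems; $\mathrm{CTO}(X\to Y)$ is the closure of the set of thermal operations from $X$ to $Y$. For real $m\ge1$ let $X$ be a qubit with Hamiltonian diagonal in $\{|0\rangle,|1\rangle\}$ whose Gibbs state is $\mathbf{u}^X_m=\frac1m|0\rangle\langle0|+\frac{m-1}m|1\rangle\langle1|$. For an auxiliary system $R$ with fixed Hamiltonian, the $R$-assisted conversion distance is $d^R_{\mathrm{CTO}}((\rho^X,\gamma^X)\to(\sigma^B,\gamma^B))\coloneqq\inf_{\omega\in\mathfrak{D}(R)}\inf_{\mathcal{E}\in\mathrm{CTO}(XR\to B)}\frac12\|\sigma^B-\mathcal{E}(\rho^X\otimes\omega^R)\|_1$,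 and the $R$-assisted $\varepsilon$-cost is $\mathrm{Cost}^{\varepsilon,R}_{\mathrm{CTO}}(\rho^B,\gamma^B)\coloneqq\log\inf\{m>0: d^R_{\mathrm{CTO}}((|0\rangle\langle0|^X,\mathbf{u}^X_m)\to(\rho^B,\gamma^B))\le\varepsilon\}$. A sublinear athermality resource (SLAR) is a sequence of systems $\{R_n\}_{n\in\mathbb{N}}$ with $|R_n|$ growing polynomially in $n$, for which there are constants $c>0$ and $0\le\alpha<1$ independent of $n$ with $\|H^{R_n}\|_\infty\le cn^\alpha$ for all $n$. Then $\mathrm{Cost}_\mathfrak{F}(\rho,\gamma)\coloneqq\lim_{\varepsilon\to0^+}\inf_{\{R_n\}}\liminf_{n\to\infty}\frac1n\mathrm{Cost}^{\varepsilon,R_n}_{\mathrm{CTO}}(\rho^{\otimes n},\gamma^{\otimes n})$, the infimum being over all SLARs. Logarithms are base 2. *)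

(* Defs.v *)
From HB Require Import structures.
From mathcomp Require Import all_boot all_order all_algebra.
From mathcomp Require Import all_classical all_reals all_analysis.
From mathcomp Require Import complex mxtens.

Set Implicit Arguments.
Unset Strict Implicit.
Unset Printing Implicit Defensive.

Import Order.TTheory GRing.Theory Num.Theory.
Local Open Scope ring_scope.
Local Open Scope classical_set_scope.

Definition adj (R : realType) m n (A : 'M[R[i]]_(m, n)) : 'M[R[i]]_(n, m) :=
  map_mx (@conjc R) A^T.

Definition hermitian (R : realType) n (A : 'M[R[i]]_n) : Prop := adj A = A.

Definition psd (R : realType) n (A : 'M[R[i]]_n) : Prop :=
  hermitian A /\ forall v : 'cV[R[i]]_n, 0 <= (adj v *m A *m v) 0 0.

Definition unitary (R : realType) n (U : 'M[R[i]]_n) : Prop :=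
  adj U *m U = 1%:M /\ U *m adj U = 1%:M.

Definition density (R : realType) n (rho : 'M[R[i]]_n) : Prop :=
  psd rho /\ \tr rho = 1.

Definition pure_state (R : realType) n (psi : 'M[R[i]]_n) : Prop :=
  exists v : 'cV[R[i]]_n, adj v *m v = 1%:M /\ psi = v *m adj v.

(* Functional calculus for Hermitian matrices: f(A) = U diag(f(d)) U^* where
   A = U diag(d) U^* with U unitary and d real (well defined; picked by choice).
   (Returns 0 if A is not unitarily diagonalisable with real spectrum.) *)
Definition fcalc (R : realType) n (f : R -> R) (A : 'M[R[i]]_n) : 'M[R[i]]_n :=
  xget 0 [set M | exists (U : 'M[R[i]]_n) (d : 'rV[R]_n),
      unitary U /\
      A = U *m diag_mx (map_mx (fun x => Complex x 0) d) *m adj U /\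
      M = U *m diag_mx (map_mx (fun x => Complex (f x) 0) d) *m adj U].

Definition tnorm (R : realType) n (M : 'M[R[i]]_n) : R :=
  complex.Re (\tr (fcalc (@Num.sqrt R) (adj M *m M))).

Definition vnorm (R : realType) n (v : 'cV[R[i]]_n) : R :=
  Num.sqrt (\sum_i (complex.Re (v i 0) ^+ 2 + complex.Im (v i 0) ^+ 2)).

Definition opnorm_le (R : realType) n (H : 'M[R[i]]_n) (b : R) : Prop :=
  forall v : 'cV[R[i]]_n, vnorm (H *m v) <= b * vnorm v.

Definition ptrace2 (R : realType) a b (M : 'M[R[i]]_(a * b)) : 'M[R[i]]_a :=
  \matrix_(i, j) \sum_(k < b) M (mxtens_index (i, k)) (mxtens_index (j, k)).

(* binary logarithm with the convention lg 0 = 0 (used for 0 log 0 = 0) *)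
Definition lg (R : realType) (x : R) : R := if 0 < x then ln x / ln 2 else 0.

Definition relent (R : realType) n (rho gamma : 'M[R[i]]_n) : R :=
  complex.Re (\tr (rho *m fcalc (@lg R) rho) - \tr (rho *m fcalc (@lg R) gamma)).

Record system (R : realType) := Sys { sdim : nat; sham : 'M[R[i]]_sdim }.

Definition valid_sys (R : realType) (S : system R) : Prop := psd (sham S).

Definition sys_prod (R : realType) (X Y : system R) : system R :=
  @Sys R (sdim X * sdim Y) (sham X *t 1%:M + 1%:M *t sham Y).

Definition sys_triv (R : realType) : system R := @Sys R 1 0.

Fixpoint sys_pow (R : realType) (A : system R) (n : nat) : system R :=
  match n with
  | 0 => sys_triv R
  | n'.+1 => sys_prod (sys_pow A n') A
  end.

Fixpoint tpow (R : realType) (A : system R) (rho : 'M[R[i]]_(sdim A)) (n : nat)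
  : 'M[R[i]]_(sdim (sys_pow A n)) :=
  match n return 'M[R[i]]_(sdim (sys_pow A n)) with
  | 0 => 1%:M
  | n'.+1 => tpow rho n' *t rho
  end.

Definition gibbs (R : realType) (beta : R) (S : system R) : 'M[R[i]]_(sdim S) :=
  let E := fcalc (fun x => expR (- beta * x)) (sham S) in (\tr E)^-1 *: E.

Definition thermal_op (R : realType) (beta : R) (X Y : system R)
    (f : 'M[R[i]]_(sdim X) -> 'M[R[i]]_(sdim Y)) : Prop :=
  exists (E A' : system R)
         (V : 'M[R[i]]_(sdim Y * sdim A', sdim X * sdim E)),
    [/\ valid_sys E /\ valid_sys A',
        adj V *m V = 1%:M /\ V *m adj V = 1%:M,
        V *m sham (sys_prod X E) = sham (sys_prod Y A') *m V &
        forall rho, f rho = ptrace2 (V *m (rho *t gibbs beta E) *m adj V)].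

(* CTO(X -> Y): closure of the thermal operations (pointwise limits of
   sequences of thermal operations; for linear maps on finite-dimensional
   spaces this is the closure in any norm). *)
Definition CTO (R : realType) (beta : R) (X Y : system R)
    (f : 'M[R[i]]_(sdim X) -> 'M[R[i]]_(sdim Y)) : Prop :=
  exists T : nat -> 'M[R[i]]_(sdim X) -> 'M[R[i]]_(sdim Y),
    (forall k, @thermal_op R beta X Y (T k)) /\
    forall rho i j (e : R), 0 < e ->
      exists N : nat, forall k, (N <= k)%N -> `|T k rho i j - f rho i j| < Complex e 0.

Definition conv_dist (R : realType) (beta : R) (X Rs B : system R)
    (rho : 'M[R[i]]_(sdim X)) (sigma : 'M[R[i]]_(sdim B)) : \bar R :=
  ereal_inf [set x : \bar R | exists (omega : 'M[R[i]]_(sdim Rs))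
        (E : 'M[R[i]]_(sdim (sys_prod X Rs)) -> 'M[R[i]]_(sdim B)),
      [/\ density omega, @CTO R beta (sys_prod X Rs) B E &
          x = (2^-1 * tnorm (sigma - E (rho *t omega)))%:E]].

(* the qubit X with Gibbs state u_m = diag(1/m, (m-1)/m) (m > 1): energies
   h0 = max(0, ln(m-1)/beta), h1 = max(0, -ln(m-1)/beta), so h1 - h0 = -ln(m-1)/beta *)
Definition qubit (R : realType) (beta m : R) : system R :=
  @Sys R 2 (diag_mx (\row_(i < 2)
     Complex (if i == 0 then Num.max 0 (ln (m - 1) / beta)
                        else Num.max 0 (- ln (m - 1) / beta)) 0)).

Definition ket0 (R : realType) : 'M[R[i]]_2 := delta_mx 0 0.

Definition elog2 (R : realType) (x : \bar R) : \bar R :=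
  match x with
  | EFin r => (ln r / ln 2)%:E
  | +oo%E => +oo%E
  | -oo%E => -oo%E
  end.

Definition cost_eps (R : realType) (beta : R) (Rs B : system R)
    (sigma : 'M[R[i]]_(sdim B)) (eps : R) : \bar R :=
  elog2 (ereal_inf [set m%:E | m in [set m : R | 1 < m /\
           (@conv_dist R beta (qubit beta m) Rs B (@ket0 R) sigma <= eps%:E)%E]]).

Definition SLAR (R : realType) (Rn : nat -> system R) : Prop :=
  (forall n, valid_sys (Rn n)) /\
  (exists (C : R) (k : nat), forall n, (0 < n)%N -> (sdim (Rn n))%:R <= C * n%:R ^+ k) /\
  (exists c alpha : R, [/\ 0 < c, 0 <= alpha, alpha < 1 &
     forall n, (0 < n)%N -> opnorm_le (sham (Rn n)) (c * n%:R `^ alpha)]).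

(* inf over SLARs of liminf_n (1/n) Cost^{eps,R_n}(rho^{(x)n}, gamma^{(x)n}) ;
   Cost_F is the limit of this quantity as eps -> 0+ *)
Definition slar_cost (R : realType) (beta : R) (A : system R)
    (rho : 'M[R[i]]_(sdim A)) (eps : R) : \bar R :=
  ereal_inf [set limn_einf (fun n : nat =>
                 ((n%:R : R)^-1)%:E * @cost_eps R beta (Rn n) (sys_pow A n) (tpow rho n) eps)%E
            | Rn in [set Rn | SLAR Rn]].

(* Main.v *)
Require Import Defs.
From HB Require Import structures.
From mathcomp Require Import all_boot all_order all_algebra.
From mathcomp Require Import all_classical all_reals all_analysis.
From mathcomp Require Import complex mxtens ring lra.
(* [hermitian] is also defined in [sesquilinear]; the one of [Defs] is meant below. *)
Import Defs.
Set Implicit Arguments.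
Unset Strict Implicit.
Unset Printing Implicit Defensive.
Import Order.TTheory GRing.Theory Num.Theory.
Import numFieldNormedType.Exports.
Local Open Scope ring_scope.
Local Open Scope classical_set_scope.

(** Write [H = U diag(h) U^*], [psi = |v><v|], [p_i = |<u_i|v>|^2],
    [mu = sum_i p_i h_i] and [Z = Tr e^{-beta H}], so that
    [D(psi || gamma) ln 2 = beta mu + ln Z].

    Lower bound.  In unnormalised form [|0><0| (x) omega] is at most
    [e^{beta h_0} e^{beta ||H^R||} e^{-beta H^{XR}}], and thermal operations preserve
    Gibbs operators, so every output is at most [m |R| e^{beta ||H^R||} gamma^{(x) n}].
    Testing this with the projection of [v^{(x) n}] onto energies within [n delta] of
    [n mu], which by Chebyshev carries almost all its weight, gives
    [m >= e^{n (beta mu + ln Z - beta delta) - o(n)}].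

    Upper bound.  The reference [R_n] carries one level per type [t], of energy
    [E(t) - E_0] with [E_0 = n mu - L sqrt n] if [t] is within [L sqrt n] of the mean,
    and holds a copy of [v^{(x) n}] truncated to those types.  The isometry sending
    level [t] to the type-[t] component of [v^{(x) n}] raises all energies by [E_0].
    This is paid for by flipping the qubit from 0 to 1 and by absorbing the thermal
    state of a copy of [B = A^n] into a bath [S] of lists over the energy basis of
    [B] with length at most [K], an extra letter costing its energy plus
    [F = ln(Z^n) / beta].  With this [F] all lengths are equally likely in the Gibbs
    state of [S], so prepending a letter fails with probability [1 / (K + 1)] only,
    while the energy balance fixes [m - 1 = Z^n e^{beta (E_0 + O(sqrt n))}]. *)

(** * Linear algebra *)

Section Adjoint.
Context {R : realType}.
Local Notation C := R[i].

Lemma adjE m n (A : 'M[C]_(m, n)) i j : adj A i j = conjc (A j i).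
Proof. by rewrite !mxE. Qed.

Lemma adjM m n p (A : 'M[C]_(m, n)) (B : 'M[C]_(n, p)) :
  adj (A *m B) = adj B *m adj A.
Proof. by rewrite /adj trmx_mul map_mxM. Qed.

Lemma adjK m n (A : 'M[C]_(m, n)) : adj (adj A) = A.
Proof. by apply/matrixP => i j; rewrite !adjE conjcK. Qed.

Lemma adjD m n (A B : 'M[C]_(m, n)) : adj (A + B) = adj A + adj B.
Proof. by apply/matrixP => i j; rewrite !(adjE, mxE) raddfD. Qed.

Lemma adjN m n (A : 'M[C]_(m, n)) : adj (- A) = - adj A.
Proof. by apply/matrixP => i j; rewrite !(adjE, mxE) raddfN. Qed.

Lemma mxBE m n (A B : 'M[C]_(m, n)) i j : (A - B) i j = A i j - B i j.
Proof. by rewrite !mxE. Qed.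

Lemma adjB m n (A B : 'M[C]_(m, n)) : adj (A - B) = adj A - adj B.
Proof. by rewrite adjD adjN. Qed.

Lemma adj0 m n : adj (0 : 'M[C]_(m, n)) = 0.
Proof. by apply/matrixP => i j; rewrite !(adjE, mxE) conjc0. Qed.

Lemma adj1 n : adj (1%:M : 'M[C]_n) = 1%:M.
Proof. by rewrite /adj trmx1 map_mx1. Qed.

Lemma adjZ m n (a : C) (A : 'M[C]_(m, n)) : adj (a *: A) = conjc a *: adj A.
Proof. by apply/matrixP => i j; rewrite !(adjE, mxE) rmorphM. Qed.

Lemma adj_tens m n p q (A : 'M[C]_(m, n)) (B : 'M[C]_(p, q)) :
  adj (A *t B) = adj A *t adj B.
Proof. by apply/matrixP => i j; rewrite !(adjE, mxE) rmorphM. Qed.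

Lemma adj_mul_self_ge0 n (v : 'cV[C]_n) : 0 <= (adj v *m v) 0 0.
Proof. by rewrite mxE sumr_ge0 // => i _; rewrite adjE mulrC mulcJ_ge0. Qed.

(** Has the shape of the diagonal matrices in [fcalc], so that spectral decompositions match that
    definition by conversion. *)
Definition rdiag n (d : 'rV[R]_n) : 'M[C]_n :=
  diag_mx (map_mx (fun x => Complex x 0) d).

Lemma rdiagE n (d : 'rV[R]_n) i j :
  rdiag d i j = if i == j then (d 0 i)%:C%C else 0.
Proof. by rewrite !mxE; case: eqP => [->|]; rewrite ?mulr1n ?mulr0n. Qed.

Lemma adj_rdiag n (d : 'rV[R]_n) : adj (rdiag d) = rdiag d.
Proof.
apply/matrixP => i j; rewrite adjE !rdiagE eq_sym.
by case: eqP => [->|_]; rewrite ?conjc_real ?conjc0.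
Qed.

Lemma mul_rdiagE m n (A : 'M[C]_(m, n)) (d : 'rV[R]_n) i j :
  (A *m rdiag d) i j = A i j * (d 0 j)%:C%C.
Proof. by rewrite mul_mx_diag !mxE. Qed.

Lemma rdiag_mulE m n (d : 'rV[R]_m) (A : 'M[C]_(m, n)) i j :
  (rdiag d *m A) i j = (d 0 i)%:C%C * A i j.
Proof. by rewrite mul_diag_mx !mxE. Qed.

Lemma rdiagM n (d e : 'rV[R]_n) :
  rdiag d *m rdiag e = rdiag (\row_i (d 0 i * e 0 i)).
Proof.
apply/matrixP => i j; rewrite rdiag_mulE !rdiagE mxE.
by case: eqP => _; rewrite ?mulr0 // -rmorphM.
Qed.

Lemma rdiag1 n : rdiag (const_mx 1 : 'rV[R]_n) = 1%:M.
Proof. by apply/matrixP => i j; rewrite rdiagE !mxE; case: eqP. Qed.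

Lemma rdiagB n (d e : 'rV[R]_n) : rdiag (d - e) = rdiag d - rdiag e.
Proof.
apply/matrixP => i j; rewrite mxE [in RHS]mxE !rdiagE !mxE.
by case: eqP => _; rewrite ?subrr // -rmorphB; rewrite ?subr0.
Qed.

Lemma rdiagZ n (a : R) (d : 'rV[R]_n) : rdiag (a *: d) = a%:C%C *: rdiag d.
Proof.
apply/matrixP => i j; rewrite [in RHS]mxE !rdiagE !mxE.
by case: eqP => _; rewrite ?mulr0 // -rmorphM.
Qed.

Lemma tr_rdiag n (d : 'rV[R]_n) : \tr (rdiag d) = (\sum_i d 0 i)%:C%C.
Proof.
by rewrite rmorph_sum; apply: eq_bigr => i _; rewrite rdiagE eqxx.
Qed.

End Adjoint.

(** * Tensor products and partial trace *)

Section Tensor.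
Context {R : realType}.
Local Notation C := R[i].

Lemma tensmxDl m n p q (A B : 'M[C]_(m, n)) (D : 'M[C]_(p, q)) :
  (A + B) *t D = A *t D + B *t D.
Proof. by apply/matrixP => i j; rewrite !mxE mulrDl. Qed.

Lemma tensmxDr m n p q (D : 'M[C]_(m, n)) (A B : 'M[C]_(p, q)) :
  D *t (A + B) = D *t A + D *t B.
Proof. by apply/matrixP => i j; rewrite !mxE mulrDr. Qed.

Lemma tensmxZl m n p q a (A : 'M[C]_(m, n)) (B : 'M[C]_(p, q)) :
  (a *: A) *t B = a *: (A *t B).
Proof. by apply/matrixP => i j; rewrite !mxE mulrA. Qed.

Lemma tensmxZr m n p q a (A : 'M[C]_(m, n)) (B : 'M[C]_(p, q)) :
  A *t (a *: B) = a *: (A *t B).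
Proof. by apply/matrixP => i j; rewrite !mxE mulrCA. Qed.

Lemma tensmxBl m n p q (A B : 'M[C]_(m, n)) (D : 'M[C]_(p, q)) :
  (A - B) *t D = A *t D - B *t D.
Proof. by rewrite tensmxDl -scaleN1r tensmxZl scaleN1r. Qed.

Lemma tensmxBr m n p q (D : 'M[C]_(m, n)) (A B : 'M[C]_(p, q)) :
  D *t (A - B) = D *t A - D *t B.
Proof. by rewrite tensmxDr -scaleN1r tensmxZr scaleN1r. Qed.

Lemma mxtens_index_inj m n : injective (@mxtens_index m n).
Proof. exact: can_inj (@mxtens_indexK m n). Qed.

Lemma tens11 m n : (1%:M : 'M[C]_m) *t (1%:M : 'M[C]_n) = 1%:M.
Proof.
apply/matrixP => i j; case: (mxtens_indexP i) => i1 i2.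
case: (mxtens_indexP j) => j1 j2; rewrite tensmxE !mxE.
by rewrite (inj_eq (@mxtens_index_inj _ _)) xpair_eqE -natrM mulnb.
Qed.

Lemma sum_mxtens (V : nmodType) m n (F : 'I_(m * n) -> V) :
  \sum_k F k = \sum_i \sum_j F (mxtens_index (i, j)).
Proof.
rewrite pair_big (reindex (@mxtens_index m n)) /=.
  by apply: eq_bigr => -[].
by exists (@mxtens_unindex m n) => i _; rewrite (mxtens_indexK, mxtens_unindexK).
Qed.

Lemma tr_tens m n (A : 'M[C]_m) (B : 'M[C]_n) : \tr (A *t B) = \tr A * \tr B.
Proof.
rewrite /mxtrace sum_mxtens mulr_suml; apply: eq_bigr => i _.
by rewrite mulr_sumr; apply: eq_bigr => j _; rewrite tensmxE.
Qed.

Lemma ptrace2_tens m n (A : 'M[C]_m) (B : 'M[C]_n) :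
  ptrace2 (A *t B) = \tr B *: A.
Proof.
apply/matrixP => i j; rewrite !mxE /mxtrace mulr_suml; apply: eq_bigr => k _.
by rewrite tensmxE mulrC.
Qed.

Lemma ptrace2D m n (A B : 'M[C]_(m * n)) :
  ptrace2 (A + B) = ptrace2 A + ptrace2 B.
Proof.
apply/matrixP => i j; rewrite !mxE -big_split; apply: eq_bigr => k _.
by rewrite mxE.
Qed.

Lemma ptrace2Z m n a (A : 'M[C]_(m * n)) :
  ptrace2 (a *: A) = a *: ptrace2 A.
Proof.
apply/matrixP => i j; rewrite !mxE mulr_sumr; apply: eq_bigr => k _.
by rewrite mxE.
Qed.

Lemma tr_ptrace2 m n (A : 'M[C]_(m * n)) : \tr (ptrace2 A) = \tr A.
Proof. by rewrite [RHS]sum_mxtens; apply: eq_bigr => i _; rewrite mxE. Qed.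

Lemma rdiag_tens m n (d : 'rV[R]_m) (e : 'rV[R]_n) :
  rdiag d *t rdiag e = rdiag (\row_k (d 0 (mxtens_unindex k).1 * e 0 (mxtens_unindex k).2)).
Proof.
apply/matrixP => i j; case: (mxtens_indexP i) => i1 i2.
case: (mxtens_indexP j) => j1 j2; rewrite tensmxE !rdiagE !mxE.
rewrite (inj_eq (@mxtens_index_inj _ _)) xpair_eqE !mxtens_indexK /=.
by do 2!case: eqP => _ /=; rewrite ?mul0r ?mulr0 // -rmorphM.
Qed.

Lemma rdiag_tens_sum m n (d : 'rV[R]_m) (e : 'rV[R]_n) :
  rdiag d *t 1%:M + 1%:M *t rdiag e =
  rdiag (\row_k (d 0 (mxtens_unindex k).1 + e 0 (mxtens_unindex k).2)).
Proof.
apply/matrixP => i j; case: (mxtens_indexP i) => i1 i2.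
case: (mxtens_indexP j) => j1 j2; rewrite mxE !tensmxE !rdiagE !mxE.
rewrite (inj_eq (@mxtens_index_inj _ _)) xpair_eqE !mxtens_indexK /=.
do 2!case: eqP => _ /=; rewrite ?(mul0r, mulr0, mul1r, mulr1, addr0) //.
by rewrite -rmorphD.
Qed.

End Tensor.

(** * Spectral theorem and functional calculus *)

Section Spectral.
Context {R : realType}.
Local Notation C := R[i].

Lemma hermitian_spectral n (A : 'M[C]_n) : hermitian A ->
  exists (U : 'M[C]_n) (d : 'rV[R]_n),
    unitary U /\ A = U *m rdiag d *m adj U.
Proof.
move=> hA.
have hA' : A \is @hermitianmx C n false (@Num.conj C).
  apply/is_hermitianmxP; rewrite expr0 scale1r -[LHS]hA.
  by apply/matrixP => i j; rewrite !mxE.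
have aE (P : 'M[C]_n) : map_mx (@Num.conj C) P^T = adj P by apply/matrixP => i j; rewrite !mxE.
have /orthomx_spectralP := hermitian_normalmx hA'.
have hr := hermitian_spectral_diag_real hA'.
have hU := spectral_unitarymx A; rewrite invmx_unitary // aE => eA.
exists (adj (spectralmx A)), (\row_i complex.Re (spectral_diag A 0 i)).
move/unitarymxP: hU; rewrite aE => hU; split; last first.
  rewrite adjK {1}eA; congr (_ *m _ *m _); congr diag_mx.
  apply/rowP => i; rewrite !mxE; move/mxOverP/(_ 0 i): hr => /RRe_real {1}<- //.
by split; rewrite adjK //; apply: mulmx1C.
Qed.

(** The choice made in [fcalc] is immaterial: if [V diag(e) V^*] and [U diag(d) U^*] agree, then
    [W = V^* U] satisfies [e_i W_ij = W_ij d_j], so [W_ij] vanishes unless [e_i = d_j], and hence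
    [f(e) W = W f(d)]. *)
Lemma fcalcE m n (f : R -> R) (A : 'M[C]_n) (U : 'M[C]_(n, m)) (d : 'rV[R]_m) :
  adj U *m U = 1%:M -> U *m adj U = 1%:M ->
  A = U *m rdiag d *m adj U ->
  fcalc f A = U *m rdiag (map_mx f d) *m adj U.
Proof.
move=> UU UU' eA; rewrite /fcalc.
have hA : hermitian A by rewrite /hermitian eA !adjM adjK adj_rdiag mulmxA.
have [U0 [d0 [hU0 eA0]]] := hermitian_spectral hA.
set S := (X in xget _ X).
have : S (U0 *m rdiag (map_mx f d0) *m adj U0).
  exists U0, d0; split=> //; split=> //; congr (_ *m _ *m _).
  by congr diag_mx; apply/rowP => i; rewrite !mxE.
move=> /(xgetI 0) [V [e [[VV VV'] [eA' ->]]]].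
pose W := adj V *m U.
have eqW : rdiag e *m W = W *m rdiag d.
  rewrite -[RHS]mulmx1 -UU mulmxA -[W *m _ *m _]mulmxA.
  rewrite /W -!mulmxA [X in _ = adj V *m X]mulmxA [X in _ = adj V *m X]mulmxA.
  rewrite -eA eA' -/(rdiag e) !mulmxA VV mul1mx; congr (_ *m _).
have eqfW : rdiag (map_mx f e) *m W = W *m rdiag (map_mx f d).
  apply/matrixP => i j; move/matrixP/(_ i j): eqW.
  rewrite !rdiag_mulE !mul_rdiagE !mxE [RHS]mulrC => /eqP.
  rewrite -subr_eq0 -mulrBl -rmorphB mulf_eq0 => /orP[/eqP/complexI/eqP|/eqP ->].
    by rewrite subr_eq0 => /eqP ->; rewrite mulrC.
  by rewrite !mul0r mulr0.
have -> : diag_mx (map_mx (fun x => Complex (f x) 0) e) = rdiag (map_mx f e).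
  by congr diag_mx; apply/rowP => i; rewrite !mxE.
have : V *m (rdiag (map_mx f e) *m W) *m adj U = V *m (W *m rdiag (map_mx f d)) *m adj U.
  by rewrite eqfW.
by rewrite /W !mulmxA VV' mul1mx -!mulmxA UU' mulmx1.
Qed.

End Spectral.

(** * Positive semidefinite matrices *)

Section Psd.
Context {R : realType}.
Local Notation C := R[i].

Lemma psd_gram m n (D : 'M[C]_(m, n)) : psd (D *m adj D).
Proof.
split; first by rewrite /hermitian adjM adjK.
move=> v; have -> : adj v *m (D *m adj D) *m v = adj (adj D *m v) *m (adj D *m v).
  by rewrite adjM adjK !mulmxA.
exact: adj_mul_self_ge0.
Qed.

Lemma psd_spectral n (A : 'M[C]_n) : psd A ->
  exists (U : 'M[C]_n) (d : 'rV[R]_n),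
    [/\ unitary U, A = U *m rdiag d *m adj U & forall i, 0 <= d 0 i].
Proof.
move=> [hA pA]; have [U [d [[UU UU'] eA]]] := hermitian_spectral hA.
exists U, d; split=> // i.
pose e : 'cV[C]_n := delta_mx i 0; have := pA (U *m e).
have -> : adj (U *m e) *m A *m (U *m e) = adj e *m rdiag d *m e.
  rewrite eA adjM !mulmxA -[adj e *m _ *m _]mulmxA UU mulmx1.
  by rewrite -[_ *m adj U *m _]mulmxA UU mulmx1.
rewrite !mxE (bigD1 i) //= big1 ?addr0; last first.
  by move=> j /negPf ji; rewrite [X in _ * X]mxE ji mulr0.
rewrite mul_rdiagE adjE !mxE !eqxx mulr1 rmorph1 mul1r.
by rewrite ler0c.
Qed.

Lemma psd_factor n (A : 'M[C]_n) : psd A -> exists D : 'M[C]_n, A = D *m adj D.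
Proof.
move=> /psd_spectral[U [d [_ -> d0]]].
exists (U *m rdiag (map_mx Num.sqrt d)); rewrite adjM adj_rdiag.
rewrite !mulmxA; congr (_ *m _); rewrite -!mulmxA; congr (_ *m _).
by rewrite rdiagM; congr rdiag; apply/rowP => i; rewrite !mxE -expr2 sqr_sqrtr.
Qed.

Lemma psd_rdiag n (U : 'M[C]_n) (d : 'rV[R]_n) : (forall i, 0 <= d 0 i) ->
  psd (U *m rdiag d *m adj U).
Proof.
move=> d0; have -> : U *m rdiag d *m adj U =
   (U *m rdiag (map_mx Num.sqrt d)) *m adj (U *m rdiag (map_mx Num.sqrt d)).
  rewrite adjM adj_rdiag !mulmxA; congr (_ *m _).
  rewrite -!mulmxA rdiagM; congr (_ *m rdiag _).
  by apply/rowP => i; rewrite !mxE -expr2 sqr_sqrtr.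
exact: psd_gram.
Qed.

Lemma psd_tens m n (A : 'M[C]_m) (B : 'M[C]_n) : psd A -> psd B -> psd (A *t B).
Proof.
move=> /psd_factor[D ->] /psd_factor[F ->]; rewrite -tensmx_mul -adj_tens.
exact: psd_gram.
Qed.

Lemma psd_conj m n (V : 'M[C]_(m, n)) A : psd A -> psd (V *m A *m adj V).
Proof.
move=> /psd_factor[D ->].
rewrite !mulmxA -[_ *m adj D *m _]mulmxA -adjM; exact: psd_gram.
Qed.

Lemma psdD n (A B : 'M[C]_n) : psd A -> psd B -> psd (A + B).
Proof.
move=> [hA pA] [hB pB]; split; first by rewrite /hermitian adjD hA hB.
by move=> v; rewrite mulmxDr mulmxDl mxE addr_ge0.
Qed.

Lemma psdZ n (a : R) (A : 'M[C]_n) : 0 <= a -> psd A -> psd (a%:C%C *: A).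
Proof.
move=> a0 [hA pA]; split; first by rewrite /hermitian adjZ conjc_real hA.
by move=> v; rewrite -scalemxAr -scalemxAl mxE mulr_ge0 // ler0c.
Qed.

(** The quadratic form of the partial trace at [v] is the sum over [k] of that of [A] at [w k], the
    tensor product of [v] with the [k]-th basis vector. *)
Lemma psd_ptrace2 m n (A : 'M[C]_(m * n)) : psd A -> psd (ptrace2 A).
Proof.
move=> [hA pA]; split.
  apply/matrixP => i j; rewrite adjE !mxE rmorph_sum; apply: eq_bigr => k _.
  by rewrite -[in RHS]hA adjE.
move=> v; pose w k : 'cV[C]_(m * n) :=
  \col_ij (v (mxtens_unindex ij).1 0 * ((mxtens_unindex ij).2 == k)%:R).
suff -> : (adj v *m ptrace2 A *m v) 0 0 = \sum_k (adj (w k) *m A *m w k) 0 0.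
  by apply: sumr_ge0 => k _; exact: pA.
have wE k : (adj (w k) *m A *m w k) 0 0 = \sum_j \sum_i
    conjc (v i 0) * A (mxtens_index (i, k)) (mxtens_index (j, k)) * v j 0.
  rewrite mxE sum_mxtens; apply: eq_bigr => j _.
  rewrite (bigD1 k) //= big1 ?addr0; last first.
    by move=> l /negPf lk; rewrite [X in _ * X]mxE mxtens_indexK /= lk !mulr0.
  rewrite [X in _ * X]mxE mxtens_indexK /= eqxx mulr1 mxE mulr_suml.
  rewrite sum_mxtens; apply: eq_bigr => i _.
  rewrite (bigD1 k) //= big1 ?addr0; last first.
    by move=> l /negPf lk; rewrite adjE mxE mxtens_indexK /= lk mulr0 conjc0 !mul0r.
  by rewrite adjE mxE mxtens_indexK /= eqxx mulr1.
rewrite (eq_bigr _ (fun k _ => wE k)) exchange_big mxE; apply: eq_bigr => j _.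
rewrite exchange_big mxE mulr_suml; apply: eq_bigr => i _.
by rewrite adjE mxE mulr_sumr mulr_suml.
Qed.

Lemma psd_tr_ge0 n (A : 'M[C]_n) : psd A -> 0 <= \tr A.
Proof.
move=> /psd_spectral[U [d [[UU _] -> d0]]].
rewrite mxtrace_mulC mulmxA UU mul1mx tr_rdiag ler0c; exact: sumr_ge0.
Qed.

End Psd.

(** * Squared norms and the trace norm *)

Section TraceNorm.
Context {R : realType}.
Local Notation C := R[i].

(** The summand of [vnorm], so that [vnorm v] is [Num.sqrt (nsq v)] by conversion. *)
Definition csq (z : C) : R := complex.Re z ^+ 2 + complex.Im z ^+ 2.

Lemma csqE (z : C) : (csq z)%:C%C = conjc z * z.
Proof.
case: z => a b; rewrite /csq /=; simpc; congr Complex; ring.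
Qed.

Lemma csq_ge0 z : 0 <= csq z.
Proof. by rewrite addr_ge0 ?sqr_ge0. Qed.

Lemma csq0 : csq (0 : C) = 0.
Proof. by rewrite /csq /= expr0n addr0. Qed.

Lemma csq_eq0 (z : C) : csq z = 0 -> z = 0.
Proof.
move=> z0; apply/eqP; have := csqE z; rewrite z0 rmorph0 => /esym/eqP.
by rewrite mulf_eq0 conjc_eq0 orbb.
Qed.

Lemma csqM y z : csq (y * z) = csq y * csq z.
Proof. by apply: complexI; rewrite rmorphM /= !csqE rmorphM; ring. Qed.

Lemma csqR (x : R) : csq x%:C%C = x ^+ 2.
Proof. by rewrite /csq /= expr0n addr0. Qed.

Definition nsq n (v : 'cV[C]_n) : R := \sum_i csq (v i 0).

Lemma nsqE n (v : 'cV[C]_n) : (adj v *m v) 0 0 = (nsq v)%:C%C.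
Proof.
rewrite mxE rmorph_sum; apply: eq_bigr => i _ /=.
by rewrite csqE adjE.
Qed.

Lemma nsq_ge0 n (v : 'cV[C]_n) : 0 <= nsq v.
Proof. by apply: sumr_ge0 => i _; exact: csq_ge0. Qed.

Lemma nsq_isom m n (U : 'M[C]_(m, n)) v : adj U *m U = 1%:M -> nsq (U *m v) = nsq v.
Proof.
move=> UU; apply: complexI; rewrite -!nsqE adjM mulmxA -[_ *m adj U *m _]mulmxA.
by rewrite UU mulmx1.
Qed.

Lemma tr_outer n (v : 'cV[C]_n) : \tr (v *m adj v) = (nsq v)%:C%C.
Proof. by rewrite mxtrace_mulC /mxtrace big_ord1 nsqE. Qed.

Lemma quad_rdiag n (d : 'rV[R]_n) (v : 'cV[C]_n) :
  (adj v *m rdiag d *m v) 0 0 = (\sum_i d 0 i * csq (v i 0))%:C%C.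
Proof.
rewrite mxE rmorph_sum; apply: eq_bigr => i _.
rewrite mul_rdiagE adjE rmorphM /= csqE; ring.
Qed.

Lemma tnorm_hermE n (U : 'M[C]_n) (d : 'rV[R]_n) : unitary U ->
  tnorm (U *m rdiag d *m adj U) = \sum_i `|d 0 i|.
Proof.
move=> [UU UU']; rewrite /tnorm.
rewrite (@fcalcE _ _ _ _ _ U (\row_i (d 0 i * d 0 i))) //; last first.
  rewrite !adjM adjK adj_rdiag -rdiagM !mulmxA.
  by rewrite -[_ *m adj U *m U]mulmxA UU mulmx1.
rewrite mxtrace_mulC mulmxA UU mul1mx tr_rdiag /=; apply: eq_bigr => i _.
by rewrite !mxE -expr2 sqrtr_sqr.
Qed.

(** In an eigenbasis of [M] the form is a sum of eigenvalues with weights at most 1, hence at most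
    the sum of their moduli. *)
Lemma quad_le_tnorm n (M : 'M[C]_n) (v : 'cV[C]_n) : hermitian M -> nsq v <= 1 ->
  (adj v *m M *m v) 0 0 <= (tnorm M)%:C%C.
Proof.
move=> hM v1; have [U [d [hU eM]]] := hermitian_spectral hM.
rewrite eM tnorm_hermE //; case: hU => UU UU'.
have -> : adj v *m (U *m rdiag d *m adj U) *m v =
          adj (adj U *m v) *m rdiag d *m (adj U *m v).
  by rewrite adjM adjK !mulmxA.
rewrite quad_rdiag lecR ler_sum // => i _.
apply: (@le_trans _ _ (`|d 0 i| * csq ((adj U *m v) i 0))).
  by rewrite ler_wpM2r ?csq_ge0 // ler_norm.
rewrite ler_piMr ?normr_ge0 //; apply: le_trans v1.
rewrite -(@nsq_isom _ _ (adj U) v) ?adjK // /nsq (bigD1 i) //= lerDl.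
by apply: sumr_ge0 => j _; exact: csq_ge0.
Qed.

(** Expand the squares and bound the cross terms by [2 |s t| <= l s^2 + t^2 / l]. The free [l]
    trades the two errors against each other; in the end it is the tolerance. *)
Lemma csq_diff (l : R) (y z : C) : 0 < l ->
  `|csq (y + z) - csq y| <= l * csq y + (1 + l^-1) * csq z.
Proof.
case: y z => [a b] [c d] l0; rewrite /csq /=.
have key (s t : R) : `|2 * (s * t)| <= l * s ^+ 2 + l^-1 * t ^+ 2.
  have E1 : 0 <= (l * s - t) ^+ 2 / l by rewrite divr_ge0 ?sqr_ge0 // ltW.
  have E2 : 0 <= (l * s + t) ^+ 2 / l by rewrite divr_ge0 ?sqr_ge0 // ltW.
  have F1 : (l * s - t) ^+ 2 / l = l * s ^+ 2 + l^-1 * t ^+ 2 - 2 * (s * t).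
    by field; rewrite gt_eqF.
  have F2 : (l * s + t) ^+ 2 / l = l * s ^+ 2 + l^-1 * t ^+ 2 + 2 * (s * t).
    by field; rewrite gt_eqF.
  by rewrite ler_norml; apply/andP; split; lra.
have -> : (a + c) ^+ 2 + (b + d) ^+ 2 - (a ^+ 2 + b ^+ 2) =
  2 * (a * c) + 2 * (b * d) + (c ^+ 2 + d ^+ 2) by ring.
have := key a c; have := key b d.
have := ler_normD (2 * (a * c) + 2 * (b * d)) (c ^+ 2 + d ^+ 2).
have := ler_normD (2 * (a * c)) (2 * (b * d)).
have : `|c ^+ 2 + d ^+ 2| = c ^+ 2 + d ^+ 2 by rewrite ger0_norm // addr_ge0 ?sqr_ge0.
lra.
Qed.

(** In an eigenbasis of the difference, its eigenvalues are [|x_i|^2 - a |y_i|^2 - N'_ii], with [x]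
    and [y] the coordinates of [v] and [w]; each is bounded by [csq_diff]. It is used with [v] the
    target, [w] its typical part and [N] the residue of a preparation that succeeds with weight
    [a]. *)
Lemma tnorm_pure_le n (v w : 'cV[C]_n) (N : 'M[C]_n) (a l t : R) :
  psd N -> \tr N = t%:C%C -> 0 < l -> a <= 1 ->
  tnorm (v *m adj v - (a%:C%C *: (w *m adj w) + N)) <=
    l * nsq w + (1 + l^-1) * nsq (v - w) + (1 - a) * nsq w + t.
Proof.
move=> pN tN l0 a1; set M := v *m adj v - _.
have hM : hermitian M.
  by rewrite /hermitian /M adjB adjD adjZ !adjM !adjK conjc_real pN.1.
have [U [d [hU eM]]] := hermitian_spectral hM.
rewrite eM tnorm_hermE //; case: hU => UU UU'.
pose x := adj U *m v; pose y := adj U *m w; pose N' := adj U *m N *m U.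
have eD : rdiag d = x *m adj x - (a%:C%C *: (y *m adj y) + N').
  have -> : rdiag d = adj U *m M *m U.
    by rewrite eM !mulmxA UU mul1mx -mulmxA UU mulmx1.
  rewrite /M mulmxBr mulmxBl mulmxDr mulmxDl -scalemxAr -scalemxAl.
  by rewrite /x /y /N' !adjM adjK !mulmxA.
have pN' : psd N' by rewrite /N' -{2}[U]adjK; exact: psd_conj.
have N'ge0 i : 0 <= N' i i.
  have := pN'.2 (delta_mx i 0); rewrite mxE (bigD1 i) //= big1 ?addr0; last first.
    by move=> j /negPf ji; rewrite [X in _ * X]mxE ji mulr0.
  rewrite [X in _ * X]mxE !eqxx mulr1 mxE (bigD1 i) //= big1 ?addr0; last first.
    by move=> j /negPf ji; rewrite adjE mxE ji conjc0 mul0r.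
  by rewrite adjE mxE !eqxx rmorph1 mul1r.
have N'E i : N' i i = (complex.Re (N' i i))%:C%C by rewrite RRe_real // ger0_real.
have dE i : d 0 i = csq (x i 0) - (a * csq (y i 0) + complex.Re (N' i i)).
  have realE (p q r : R) : (p - (a * q + r))%:C%C = p%:C%C - (a%:C%C * q%:C%C + r%:C%C).
    by rewrite rmorphB rmorphD rmorphM.
  apply: complexI; rewrite realE -N'E !csqE; move/matrixP/(_ i i): eD.
  rewrite rdiagE eqxx => ->; rewrite [LHS]mxE [X in _ + X]mxE [X in - X]mxE.
  rewrite [X in _ - (X + _)]mxE [X in X - _]mxE big_ord1 adjE mulrC.
  by congr (_ - (_ * _ + _)); rewrite mxE big_ord1 adjE mulrC.
have nx : nsq x = nsq v by apply: nsq_isom; rewrite adjK.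
have ny : nsq y = nsq w by apply: nsq_isom; rewrite adjK.
have nxy : nsq (x - y) = nsq (v - w).
  by rewrite /x /y -mulmxBr; apply: nsq_isom; rewrite adjK.
have tN' : \sum_i complex.Re (N' i i) = t.
  apply: complexI; rewrite rmorph_sum -tN.
  rewrite -[N in RHS]mul1mx -UU' -mulmxA mxtrace_mulC.
  by apply: eq_bigr => i _; rewrite /= -N'E.
rewrite -ny -nxy -tN' /nsq !mulr_sumr -!big_split ler_sum // => i _.
rewrite dE; have := @csq_diff l (y i 0) ((x - y) i 0) l0.
have -> : y i 0 + (x - y) i 0 = x i 0 by rewrite !mxE; ring.
have /= := N'ge0 i; rewrite N'E ler0c => h1 h2.
have h3 := csq_ge0 (y i 0).
have -> : csq (x i 0) - (a * csq (y i 0) + complex.Re (N' i i)) =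
 (csq (x i 0) - csq (y i 0)) + (1 - a) * csq (y i 0) - complex.Re (N' i i) by ring.
apply: le_trans (ler_normB _ _) _; rewrite (ger0_norm h1) lerD2r.
apply: le_trans (ler_normD _ _) _; rewrite lerD //.
by rewrite ger0_norm // mulr_ge0 ?subr_ge0.
Qed.

End TraceNorm.

(** * Tensor powers *)

Section Powers.
Context {R : realType}.
Local Notation C := R[i].

(* [psa] is the coordinate vector of [psi^{(x) n}] in the energy basis [psU], and
   [psty x i] counts the occurrences of the letter [i] in the basis string [x]. *)
Record pow_spectrum (A : system R) (psi : 'M[C]_(sdim A)) (h : 'rV[R]_(sdim A))
    (beta Z mu var : R) (n : nat) := PowSpectrum {
  psU : 'M[C]_(sdim (sys_pow A n));
  psh : 'rV[R]_(sdim (sys_pow A n));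
  psa : 'cV[C]_(sdim (sys_pow A n));
  psty : 'I_(sdim (sys_pow A n)) -> {ffun 'I_(sdim A) -> 'I_n.+1};
  psU_unitary : unitary psU;
  ps_sham : sham (sys_pow A n) = psU *m rdiag psh *m adj psU;
  ps_tpow : tpow psi n = (psU *m psa) *m adj (psU *m psa);
  ps_norm : nsq psa = 1;
  ps_mean : \sum_x csq (psa x 0) * psh 0 x = n%:R * mu;
  ps_var : \sum_x csq (psa x 0) * (psh 0 x - n%:R * mu) ^+ 2 = n%:R * var;
  ps_Z : \sum_x expR (- beta * psh 0 x) = Z ^+ n;
  ps_type : forall x, psh 0 x = \sum_i (psty x i)%:R * h 0 i }.

Lemma tens_colE m n (a : 'cV[C]_m) (b : 'cV[C]_n) i j (k : 'I_1) :
  (a *t b : 'M[C]_(m * n, 1)) (mxtens_index (i, j)) k = a i 0 * b j 0.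
Proof. by rewrite mxE mxtens_indexK /= !ord1. Qed.

(** Induction on [n] in the product basis, where squared amplitudes multiply and energies add. Mean
    and variance are additive because the deviation of the new letter averages to 0, and the
    partition function is multiplicative. *)
Lemma pow_spectrumP (A : system R) (U : 'M[C]_(sdim A)) (h : 'rV[R]_(sdim A))
    (a : 'cV[C]_(sdim A)) (beta : R) (n : nat)
    (p := fun i => csq (a i 0)) (mu := \sum_i p i * h 0 i) :
  unitary U -> sham A = U *m rdiag h *m adj U -> nsq a = 1 ->
  pow_spectrum ((U *m a) *m adj (U *m a)) h beta (\sum_i expR (- beta * h 0 i))
    mu (\sum_i p i * (h 0 i - mu) ^+ 2) n.
Proof.
move=> [UU UU'] eA na; set Z := \sum_i expR _; set var := \sum_i p i * _.
elim: n => [|n [V g b ty [VV VV'] gE tE nb mE vE zE tyE]].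
  apply: (@PowSpectrum _ _ _ _ _ _ _ 0 1%:M 0 1%:M (fun _ => [ffun _ => ord0])).
  - by split; rewrite adj1 mulmx1.
  - rewrite adj1 mul1mx mulmx1 /=.
    by apply/matrixP => i j; rewrite rdiagE !mxE; case: eqP.
  - by rewrite !mulmx1 adj1 mulmx1.
  - by rewrite /nsq big_ord1 mxE eqxx csqR expr1n.
  - by rewrite big_ord1 !mxE mul0r mulr0.
  - by rewrite big_ord1 !mxE !mul0r subrr expr0n /= mulr0.
  - by rewrite big_ord1 !mxE mulr0 expR0.
  - by move=> x; rewrite mxE big1 // => i _; rewrite ffunE mul0r.
have p1 : \sum_i p i = 1 by [].
have nb' : \sum_x csq (b x 0) = 1 by [].
have dev0 : \sum_x csq (b x 0) * (g 0 x - n%:R * mu) = 0.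
  under eq_bigr do rewrite mulrBr.
  by rewrite sumrB mE -mulr_suml nb' mul1r subrr.
have dev0' : \sum_i p i * (h 0 i - mu) = 0.
  under eq_bigr do rewrite mulrBr.
  by rewrite sumrB -mulr_suml p1 mul1r subrr.
pose g' : 'rV[R]_(sdim (sys_pow A n.+1)) :=
  \row_k (g 0 (mxtens_unindex k).1 + h 0 (mxtens_unindex k).2).
pose b' : 'cV[C]_(sdim (sys_pow A n.+1)) := b *t a.
(* A letter occurs at most [n.+1] times in the longer string, so [inord] never falls back on its
   default value; [tE'] checks this. *)
pose ty' (k : 'I_(sdim (sys_pow A n.+1))) : {ffun 'I_(sdim A) -> 'I_n.+2} :=
  [ffun j => inord (ty (mxtens_unindex k).1 j + (j == (mxtens_unindex k).2))].
have g'E x i : g' 0 (mxtens_index (x, i)) = g 0 x + h 0 i.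
  by rewrite mxE mxtens_indexK.
have b'E x i : csq (b' (mxtens_index (x, i)) 0) = csq (b x 0) * p i.
  by rewrite /b' tens_colE csqM.
apply: (@PowSpectrum _ _ _ _ _ _ _ n.+1 (V *t U) g' b' ty').
- by split; rewrite adj_tens tensmx_mul ?VV ?UU ?VV' ?UU' tens11.
- rewrite /= gE eA /g' -rdiag_tens_sum adj_tens mulmxDr mulmxDl !tensmx_mul.
  by rewrite !mulmx1 VV' UU'.
(* The tensor of two columns has width [1 * 1], which is 1 only by conversion, so the widths are
   passed explicitly. *)
- have -> : (V *t U) *m b' = (V *m b) *t (U *m a) by exact: (@tensmx_mul _ _ _ _ _ 1 1 V U b a).
  have -> : adj ((V *m b) *t (U *m a)) = adj (V *m b) *t adj (U *m a).
    exact: (@adj_tens _ _ 1 _ 1).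
  by rewrite /= tE; symmetry; exact: (@tensmx_mul _ _ 1 _ 1).
- rewrite /nsq sum_mxtens; under eq_bigr do under eq_bigr do rewrite b'E.
  by under eq_bigr do rewrite -mulr_sumr p1 mulr1.
- rewrite sum_mxtens; under eq_bigr do under eq_bigr do rewrite b'E g'E.
  transitivity (\sum_x csq (b x 0) * (g 0 x + mu)).
    apply: eq_bigr => x _; rewrite -[g 0 x in RHS]mul1r -p1 mulr_suml -big_split mulr_sumr.
    by apply: eq_bigr => i _ /=; ring.
  under eq_bigr do rewrite mulrDr.
  by rewrite big_split /= mE -mulr_suml nb' -natr1; ring.
- rewrite sum_mxtens; under eq_bigr do under eq_bigr do rewrite b'E g'E.
  transitivity (\sum_x (csq (b x 0) * (g 0 x - n%:R * mu) ^+ 2 + csq (b x 0) * var)).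
    apply: eq_bigr => x _.
    transitivity (\sum_i csq (b x 0) * ((g 0 x - n%:R * mu) ^+ 2 * p i +
       2 * (g 0 x - n%:R * mu) * (p i * (h 0 i - mu)) + p i * (h 0 i - mu) ^+ 2)).
      by apply: eq_bigr => i _; rewrite -natr1; ring.
    rewrite -mulr_sumr !big_split /= -!mulr_sumr p1 dev0' -/var; ring.
  by rewrite big_split /= vE -mulr_suml nb' -natr1; ring.
- rewrite sum_mxtens; under eq_bigr do under eq_bigr do rewrite g'E mulrDr expRD.
  by under eq_bigr do rewrite -mulr_sumr; rewrite -mulr_suml zE exprSr.
- move=> k; case: (mxtens_indexP k) => x i; rewrite g'E tyE /ty' mxtens_indexK /=.
  have tE' j : ((inord (ty x j + (j == i)) : 'I_n.+2)%:R : R) = (ty x j)%:R + (j == i)%:R.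
    rewrite -natrD inordK // ltnS; have := ltn_ord (ty x j).
    by case: (j == i); rewrite ?addn0 ?addn1 // => /ltnW.
  under [RHS]eq_bigr do rewrite ffunE tE' mulrDl.
  rewrite big_split /=; congr (_ + _); rewrite (bigD1 i) //= eqxx mul1r big1 ?addr0 //.
  by move=> j /negPf ->; rewrite mul0r.
Qed.

(** Chebyshev's inequality for the weight [w]: outside the window [(X x - c)^2] exceeds [t^2]. *)
Lemma weight_outside_le m (w : 'I_m -> R) (X : 'I_m -> R) (c t : R) :
  (forall x, 0 <= w x) -> 0 < t ->
  \sum_(x | ~~ (`|X x - c| <= t)) w x <= (\sum_x w x * (X x - c) ^+ 2) / t ^+ 2.
Proof.
move=> w0 t0; rewrite ler_pdivlMr ?exprn_gt0 // mulr_suml.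
rewrite [leRHS](bigID (fun x => ~~ (`|X x - c| <= t))) /=.
rewrite -[leLHS]addr0 lerD //; last first.
  by apply: sumr_ge0 => x _; rewrite mulr_ge0 ?sqr_ge0.
apply: ler_sum => x; rewrite -ltNge => h.
by rewrite ler_wpM2l // -[leRHS]real_normK ?num_real // lerXn2r ?nnegrE ?ltW // (lt_trans t0).
Qed.

End Powers.

(** * Domination by Gibbs operators *)

Section Gibbs.
Context {R : realType} (beta : R).
Local Notation C := R[i].

Definition expH (S : system R) : 'M[C]_(sdim S) :=
  fcalc (fun x => expR (- beta * x)) (sham S).

Definition partition_fun (S : system R) : R := complex.Re (\tr (expH S)).

Lemma expHE m (S : system R) (U : 'M[C]_(sdim S, m)) (h : 'rV[R]_m) :
  adj U *m U = 1%:M -> U *m adj U = 1%:M -> sham S = U *m rdiag h *m adj U ->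
  expH S = U *m rdiag (\row_i expR (- beta * h 0 i)) *m adj U.
Proof.
move=> UU UU' eS; rewrite /expH (fcalcE _ UU UU' eS); congr (_ *m rdiag _ *m _).
by apply/rowP => i; rewrite !mxE.
Qed.

Lemma partition_funE m (S : system R) (U : 'M[C]_(sdim S, m)) (h : 'rV[R]_m) :
  adj U *m U = 1%:M -> U *m adj U = 1%:M -> sham S = U *m rdiag h *m adj U ->
  partition_fun S = \sum_i expR (- beta * h 0 i).
Proof.
move=> UU UU' eS; rewrite /partition_fun (expHE UU UU' eS) mxtrace_mulC mulmxA UU.
by rewrite mul1mx tr_rdiag /=; apply: eq_bigr => i _; rewrite mxE.
Qed.

Lemma tr_expH (S : system R) : valid_sys S -> \tr (expH S) = (partition_fun S)%:C%C.
Proof.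
move=> /psd_spectral[U [h [[UU UU'] eS _]]].
rewrite (partition_funE UU UU' eS) (expHE UU UU' eS) mxtrace_mulC mulmxA UU.
by rewrite mul1mx tr_rdiag; congr (_%:C%C); apply: eq_bigr => i _; rewrite mxE.
Qed.

Lemma gibbsE (S : system R) : valid_sys S ->
  gibbs beta S = ((partition_fun S)^-1)%:C%C *: expH S.
Proof. by move=> vS; rewrite /gibbs -/(expH S) tr_expH // fmorphV. Qed.

Lemma psd_expH (S : system R) : valid_sys S -> psd (expH S).
Proof.
move=> /psd_spectral[U [h [[UU UU'] eS _]]]; rewrite (expHE UU UU' eS).
by apply: psd_rdiag => i; rewrite mxE expR_ge0.
Qed.

Lemma partition_fun_ge0 (S : system R) : valid_sys S -> 0 <= partition_fun S.
Proof. by move=> vS; rewrite -ler0c -tr_expH //; apply/psd_tr_ge0/psd_expH. Qed.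

Lemma psd_gibbs (S : system R) : valid_sys S -> psd (gibbs beta S).
Proof.
move=> vS; rewrite gibbsE //; apply: psdZ (psd_expH vS).
by rewrite invr_ge0 partition_fun_ge0.
Qed.

Lemma expH_prod (X Y : system R) : valid_sys X -> valid_sys Y ->
  expH (sys_prod X Y) = expH X *t expH Y.
Proof.
move=> /psd_spectral[U [h [[UU UU'] eX _]]] /psd_spectral[V [g [[VV VV'] eY _]]].
rewrite (expHE UU UU' eX) (expHE VV VV' eY).
rewrite (@expHE _ (sys_prod X Y) (U *t V)
  (\row_k (h 0 (mxtens_unindex k).1 + g 0 (mxtens_unindex k).2))).
- rewrite adj_tens -!tensmx_mul rdiag_tens; congr (_ *m rdiag _ *m _).
  by apply/rowP => k; rewrite !mxE mulrDr expRD.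
- by rewrite adj_tens tensmx_mul UU VV tens11.
- by rewrite adj_tens tensmx_mul UU' VV' tens11.
- rewrite -rdiag_tens_sum adj_tens mulmxDr mulmxDl !tensmx_mul !mulmx1 UU' VV'.
  by rewrite /= eX eY.
Qed.

Lemma valid_sys_prod (X Y : system R) : valid_sys X -> valid_sys Y ->
  valid_sys (sys_prod X Y).
Proof.
have p1 n : psd (1%:M : 'M[C]_n).
  by rewrite -[1%:M]mulmx1 -{2}adj1; exact: psd_gram.
by move=> vX vY; apply: psdD; apply: psd_tens.
Qed.

Lemma partition_fun_prod (X Y : system R) : valid_sys X -> valid_sys Y ->
  partition_fun (sys_prod X Y) = partition_fun X * partition_fun Y.
Proof.
move=> vX vY; apply: complexI; rewrite rmorphM -tr_expH; last exact: valid_sys_prod.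
by rewrite expH_prod // tr_tens !tr_expH.

Qed.

Lemma expH_conj (S T : system R) (V : 'M[C]_(sdim T, sdim S)) :
  adj V *m V = 1%:M -> V *m adj V = 1%:M -> V *m sham S = sham T *m V ->
  valid_sys S -> expH T = V *m expH S *m adj V.
Proof.
move=> VV VV' cV /psd_spectral[U [h [[UU UU'] eS _]]].
rewrite (expHE UU UU' eS) (@expHE _ T (V *m U) h); first by rewrite adjM !mulmxA.
- by rewrite adjM mulmxA -[_ *m adj V *m V]mulmxA VV mulmx1.
- by rewrite adjM mulmxA -[V *m U *m _]mulmxA UU' mulmx1.
- rewrite adjM -[LHS]mulmx1 -VV' mulmxA -cV eS !mulmxA //.
Qed.

(** Conjugation by [V] carries the Gibbs operator of [X E] to that of [Y A'], so [f] maps [expH X]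
    to [Z_X / Z_Y] times [expH Y]. As [f] is linear and positive, a domination of [M] by [expH X]
    passes to [f M]. *)
Lemma thermal_op_dominated (X Y : system R) f (M : 'M[C]_(sdim X)) (k : R)
    (v : 'cV[C]_(sdim Y)) :
  thermal_op beta f -> valid_sys X -> valid_sys Y -> 0 < partition_fun Y ->
  0 <= k -> psd (k%:C%C *: expH X - M) ->
  (adj v *m f M *m v) 0 0 <=
    (k * partition_fun X / partition_fun Y)%:C%C * (adj v *m expH Y *m v) 0 0.
Proof.
move=> [E [A' [V [[vE vA'] [VV VV'] cV fE]]]] vX vY ZY k0 pM.
have quadY : 0 <= (adj v *m expH Y *m v) 0 0 by exact: (psd_expH vY).2.
(* An environment of dimension 0 has partition function 0; as [0^-1 = 0], its Gibbs operator then
   vanishes and [f M = 0]. *)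
have [ZE0|ZE0] := eqVneq (partition_fun E) 0.
  have -> : f M = 0.
    rewrite fE gibbsE // ZE0 invr0 scale0r tensmx0 mulmx0 mul0mx.
    by apply/matrixP => i j; rewrite !mxE big1 // => l _; rewrite mxE.
  by rewrite mulmx0 mul0mx mxE mulr_ge0 // ler0c divr_ge0 ?mulr_ge0 ?partition_fun_ge0.
have eV : expH Y *t expH A' = V *m (expH X *t expH E) *m adj V.
  rewrite -!(@expH_prod _ _) //.
  exact: (@expH_conj (sys_prod X E) (sys_prod Y A') V VV VV' cV (valid_sys_prod vX vE)).
have eZ : partition_fun Y * partition_fun A' = partition_fun X * partition_fun E.
  apply: complexI; rewrite !rmorphM /= -!tr_expH // -!tr_tens eV mxtrace_mulC mulmxA.
  by rewrite VV mul1mx.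
have fX : f (expH X) = (partition_fun X / partition_fun Y)%:C%C *: expH Y.
  rewrite fE gibbsE // tensmxZr -scalemxAr -scalemxAl ptrace2Z -eV ptrace2_tens.
  rewrite tr_expH // scalerA -rmorphM; congr (_%:C%C *: _).
  have ZY0 := lt0r_neq0 ZY.
  have -> : partition_fun A' = partition_fun X * partition_fun E / partition_fun Y.
    by rewrite -eZ mulrAC divff ?mul1r.
  by field; rewrite ZE0 ZY0.
have fB : f (k%:C%C *: expH X - M) = k%:C%C *: f (expH X) - f M.
  rewrite !fE tensmxBl tensmxZl mulmxBr mulmxBl -scalemxAr -scalemxAl.
  by rewrite ptrace2D ptrace2Z -scaleN1r ptrace2Z scaleN1r.
have : psd (f (k%:C%C *: expH X - M)).
  by rewrite fE; apply/psd_ptrace2/psd_conj/psd_tens => //; exact: psd_gibbs.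
move=> [_ /(_ v)]; rewrite fB fX scalerA -rmorphM mulmxBr mulmxBl -scalemxAr -scalemxAl.
by rewrite mxE [X in _ + X]mxE [X in X - _]mxE subr_ge0 /= mulrA.
Qed.

End Gibbs.

(** * Passing to the closure of thermal operations *)

Section Limits.
Context {R : realType}.
Local Notation C := R[i].

Lemma Re_le_normc (z : C) (x : R) : `|z| <= x%:C%C -> complex.Re z <= x.
Proof.
rewrite normc_def lecR; apply: le_trans.
rewrite (le_trans (ler_norm _)) // -sqrtr_sqr ler_wsqrtr // lerDl sqr_ge0 //.
Qed.

Lemma normc_conj (z : C) : `|conjc z| = `|z|.
Proof. by rewrite !normc_def; case: z => a b /=; rewrite sqrrN. Qed.

Lemma eq0_normc_lt (z : C) : (forall e : R, 0 < e -> `|z| < e%:C%C) -> z = 0.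
Proof.
move=> h; apply/eqP; rewrite -normr_eq0 eq_le normr_ge0 andbT.
rewrite normc_def lecR; apply/ler_addgt0Pl => e e0; rewrite addr0.
by have := h e e0; rewrite normc_def ltcR => /ltW.
Qed.

(** Transfers bounds from thermal operations to their closure: only finitely many entries converge,
    so one index serves them all, and the form then moves by little. *)
Lemma psd_quad_limit n (T : nat -> 'M[C]_n) (M : 'M[C]_n) (v : 'cV[C]_n) (K : R) :
  (forall i j (e : R), 0 < e ->
     exists N, forall k, (N <= k)%N -> `|T k i j - M i j| < e%:C%C) ->
  (forall k, hermitian (T k)) ->
  (forall k, (adj v *m T k *m v) 0 0 <= K%:C%C) ->
  hermitian M /\ complex.Re ((adj v *m M *m v) 0 0) <= K.
Proof.
move=> cT pT qT.
have unif (e : R) : 0 < e -> exists k, forall i j, `|T k i j - M i j| < e%:C%C.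
  move=> e0.
  have /(_ _)/cid-/all_sig[N hN] (ij : 'I_n * 'I_n) := cT ij.1 ij.2 e e0.
  exists (\max_ij N ij) => i j; apply: (hN (i, j)).
  exact: (leq_bigmax (i, j)).
split.
  apply/matrixP => i j; apply/eqP; rewrite -subr_eq0; apply/eqP.
  apply: eq0_normc_lt => e e0; have e2 : 0 < e / 2 by rewrite divr_gt0.
  have [k hk] := unif _ e2.
  have -> : adj M i j - M i j = conjc (M j i - T k j i) + (T k i j - M i j).
    have eT : conjc (T k j i) = T k i j by rewrite -adjE pT.
    by rewrite adjE raddfB /= eT addrA subrK.
  apply: le_lt_trans (ler_normD _ _) _.
  rewrite normc_conj distrC [e]splitr rmorphD; exact: ltrD.
apply/ler_addgt0Pl => e e0.
(* [S] is the square of the sum of the [|v_i|]: a matrix with entries of modulus at most [e'] has a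
   form of modulus at most [e' S] at [v]. The 1 added to [S] guards against [S = 0]. *)
pose S : R := \sum_j \sum_i Num.sqrt (csq (v i 0)) * Num.sqrt (csq (v j 0)).
have S0 : 0 <= S.
  by do 2!(apply: sumr_ge0 => ? _); rewrite mulr_ge0 ?sqrtr_ge0.
have eS0 : 0 < e / (S + 1) by rewrite divr_gt0 // ltr_wpDl.
have [k hk] := unif _ eS0.
have := qT k; rewrite lecE => /andP[_ /= hq].
have dE : (adj v *m M *m v) 0 0 = (adj v *m (M - T k) *m v) 0 0 + (adj v *m T k *m v) 0 0.
  by rewrite mulmxBr mulmxBl mxBE subrK.
rewrite dE raddfD /= lerD //; apply: Re_le_normc.
apply: (@le_trans _ _ ((e / (S + 1)) * S)%:C%C); last first.
  rewrite lecR -mulrA ger_pMr // mulrC ler_pdivrMr ?mul1r ?lerDl //.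
  by rewrite ltr_wpDl.
rewrite mxE mulr_sumr rmorph_sum; apply: le_trans (ler_norm_sum _ _ _) _.
apply: ler_sum => j _; rewrite mxE mulr_suml mulr_sumr rmorph_sum.
apply: le_trans (ler_norm_sum _ _ _) _; apply: ler_sum => i _.
rewrite /= !normrM adjE normc_conj mxBE distrC.
rewrite mulrCA; move: (e / (S + 1)) (hk i j) => e' hk'.
rewrite !rmorphM /= -!normc_def mulrA.
by rewrite ler_wpM2r // ler_wpM2l // ltW.
Qed.

End Limits.

(** * Lower bound on the qubit parameter [m] *)

Section Converse.
Context {R : realType} (beta : R).
Local Notation C := R[i].

Lemma opnorm_le_spectrum n (U : 'M[C]_n) (d : 'rV[R]_n) (b : R) i : unitary U ->
  opnorm_le (U *m rdiag d *m adj U) b -> d 0 i <= b.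
Proof.
move=> [UU UU']; pose e : 'cV[C]_n := delta_mx i 0.
have e1 : nsq e = 1.
  rewrite /nsq (bigD1 i) //= big1 ?addr0; last first.
    by move=> j /negPf ji; rewrite mxE ji /csq /= expr0n addr0.
  by rewrite mxE !eqxx csqR expr1n.
move=> /(_ (U *m e)); rewrite /vnorm -![\sum_j _]/(nsq _).
have -> : U *m rdiag d *m adj U *m (U *m e) = U *m ((d 0 i)%:C%C *: e).
  rewrite mulmxA -[_ *m adj U *m U]mulmxA UU mulmx1 -mulmxA; congr (_ *m _).
  apply/colP => j; rewrite rdiag_mulE !mxE.
  by case: eqP => [->|] //; rewrite !mulr0.
rewrite !nsq_isom // e1 sqrtr1 mulr1.
have -> : nsq ((d 0 i)%:C%C *: e) = d 0 i ^+ 2.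
  rewrite -[RHS]mulr1 -e1 /nsq mulr_sumr; apply: eq_bigr => j _.
  by rewrite [in LHS]mxE csqM csqR.
by rewrite sqrtr_sqr; apply: le_trans; rewrite ler_norm.
Qed.

(** The eigenvalues of a density matrix are nonnegative with sum 1, so none exceeds 1. *)
Lemma psd_1B_density n (w : 'M[C]_n) : density w -> psd (1%:M - w).
Proof.
move=> [/psd_spectral[U [d [[UU UU'] eW d0]]] tW].
have -> : 1%:M - w = U *m rdiag (const_mx 1 - d) *m adj U.
  by rewrite rdiagB rdiag1 mulmxBr mulmxBl mulmx1 UU' eW.
apply: psd_rdiag => i; rewrite !mxE subr_ge0.
move: tW; rewrite eW mxtrace_mulC mulmxA UU mul1mx tr_rdiag => /complexI <-.
by rewrite (bigD1 i) //= lerDl sumr_ge0.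
Qed.

Definition qubit_energy (m : R) : 'rV[R]_2 :=
  \row_(i < 2) (if i == 0 then Num.max 0 (ln (m - 1) / beta)
                else Num.max 0 (- ln (m - 1) / beta)).

Lemma qubitE m : qubit beta m = Sys (rdiag (qubit_energy m)).
Proof. by congr (@Sys R 2 (diag_mx _)); apply/rowP => i; rewrite !mxE. Qed.

Lemma qubit_energy_ge0 m i : 0 <= qubit_energy m 0 i.
Proof. by rewrite mxE; case: eqP; rewrite le_max lexx. Qed.

Lemma valid_rdiag n (d : 'rV[R]_n) : (forall i, 0 <= d 0 i) -> valid_sys (Sys (rdiag d)).
Proof.
by move=> d0; have := @psd_rdiag _ _ 1%:M d d0; rewrite mul1mx adj1 mulmx1.
Qed.

Lemma valid_qubit m : valid_sys (qubit beta m).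
Proof. by rewrite qubitE; apply: valid_rdiag; exact: qubit_energy_ge0. Qed.

Lemma qubit_energy_gap m :
  qubit_energy m 0 0 - qubit_energy m 0 1 = ln (m - 1) / beta.
Proof.
rewrite !mxE /= mulNr; set y := ln _ / _.
have [y0|y0] := leP 0 y.
  by rewrite max_l ?oppr_le0 // subr0.
by rewrite max_r ?sub0r ?opprK // oppr_ge0 ltW.
Qed.

Lemma expH_rdiag n (d : 'rV[R]_n) :
  expH beta (Sys (rdiag d)) = rdiag (\row_i expR (- beta * d 0 i)).
Proof.
have a1 : adj (1%:M : 'M[C]_n) = 1%:M := adj1 _.
rewrite (@expHE _ beta n (Sys (rdiag d)) 1%:M d) ?a1 ?mulmx1 ?mul1mx //.
Qed.

Lemma expH_qubit m :
  expH beta (qubit beta m) = rdiag (\row_i expR (- beta * qubit_energy m 0 i)).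
Proof.
have a1 : adj (1%:M : 'M[C]_2) = 1%:M := adj1 _.
rewrite (@expHE _ beta 2 (qubit beta m) 1%:M (qubit_energy m)) ?a1 ?mulmx1 ?mul1mx //.
by congr diag_mx; apply/rowP => i; rewrite !mxE.
Qed.

Lemma partition_fun_rdiag n (d : 'rV[R]_n) :
  partition_fun beta (Sys (rdiag d)) = \sum_i expR (- beta * d 0 i).
Proof.
by rewrite /partition_fun expH_rdiag tr_rdiag /=; apply: eq_bigr => i _; rewrite mxE.
Qed.

(** The Gibbs weight of [|0>] is therefore [1/m], as [u_m] requires; the computation is
    [1 + e^{beta (h0 - h1)} = 1 + (m - 1)]. *)
Lemma partition_fun_qubit m : 0 < beta -> 1 < m ->
  expR (beta * qubit_energy m 0 0) * partition_fun beta (qubit beta m) = m.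
Proof.
move=> b0 m1; rewrite qubitE partition_fun_rdiag big_ord_recl big_ord1 mulrDr -!expRD.
have -> : lift ord0 ord0 = 1 :> 'I_2 by apply: val_inj.
rewrite mulNr subrr expR0 mulNr -mulrBr qubit_energy_gap.
rewrite mulrCA divff ?gt_eqF // mulr1 lnK ?posrE ?subr_gt0 //; ring.
Qed.

(** Telescoping: [c X (x) d Y - p (x) w] is [(c X - p) (x) d Y + p (x) (d Y - w)], with [X] and [Y]
    standing for the Gibbs operators. *)
Lemma psd_expH_tensB (X Y : system R) (p : 'M[C]_(sdim X)) (w : 'M[C]_(sdim Y)) (c d : R) :
  valid_sys X -> valid_sys Y -> 0 <= d -> psd p ->
  psd (c%:C%C *: expH beta X - p) -> psd (d%:C%C *: expH beta Y - w) ->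
  psd ((c * d)%:C%C *: expH beta (sys_prod X Y) - p *t w).
Proof.
move=> vX vY d0 pp pX pY.
have -> : (c * d)%:C%C *: expH beta (sys_prod X Y) - p *t w =
    (c%:C%C *: expH beta X - p) *t (d%:C%C *: expH beta Y) +
    p *t (d%:C%C *: expH beta Y - w).
  rewrite (expH_prod beta vX vY) tensmxBl tensmxBr addrA subrK tensmxZl tensmxZr.
  by rewrite scalerA -rmorphM.
exact: psdD (psd_tens pX (psdZ d0 (psd_expH beta vY))) (psd_tens pp pY).
Qed.

(** Some output lies within [e] of [sigma] in half the trace norm, so its form at [v] falls short of
    that of [sigma] by at most [2 e]. The output itself is dominated by the Gibbs operator of [B],
    with a factor controlled by [k Z_X Z_R <= m |R| e^{beta b}]. *)
Lemma conv_dist_dominated (Rs B : system R) (m b eps e : R)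
    (sigma : 'M[C]_(sdim B)) (v : 'cV[C]_(sdim B)) :
  0 < beta -> 1 < m -> valid_sys Rs -> opnorm_le (sham Rs) b -> valid_sys B ->
  0 < partition_fun beta B -> hermitian sigma -> nsq v <= 1 ->
  (@conv_dist R beta (qubit beta m) Rs B (@ket0 R) sigma <= eps%:E)%E -> eps < e ->
  complex.Re ((adj v *m sigma *m v) 0 0) <= 2 * e +
    m * (sdim Rs)%:R * expR (beta * b) *
    ((partition_fun beta B)^-1 * complex.Re ((adj v *m expH beta B *m v) 0 0)).
Proof.
move=> b0 m1 vR oR vB ZB hs v1 dist epse.
(* The infimum need not be attained, which is why [e] is strictly above [eps]. *)
have : (@conv_dist R beta (qubit beta m) Rs B (@ket0 R) sigma < e%:E)%E.
  by apply: le_lt_trans dist _; rewrite lte_fin.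
move=> /ereal_inf_lt[_ [w [E [dw [T [thT cT]] ->]]]]; rewrite lte_fin => dE.
set rho := @ket0 R *t w in dE.
pose X := qubit beta m; pose k := expR (beta * qubit_energy m 0 0) * expR (beta * b).
have vX : valid_sys X := valid_qubit m.
have vP : valid_sys (sys_prod X Rs) := valid_sys_prod vX vR.
have [U [d [[UU UU'] eR d0]]] := psd_spectral vR.
have pk0 : psd (@ket0 R).
  suff -> : @ket0 R = rdiag (\row_i (i == 0)%:R) *m adj (rdiag (\row_i (i == 0)%:R)).
    exact: psd_gram.
  rewrite adj_rdiag rdiagM; apply/matrixP => i j; rewrite rdiagE !mxE -natrM mulnb andbb.
  case: (i =P j) => [->|]; first by rewrite andbb; case: eqP.
  by case: (i =P 0) => [->|] //; case: (j =P 0) => [->|].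
have k0 : 0 <= k by rewrite mulr_ge0 ?expR_ge0.
have pX : psd ((expR (beta * qubit_energy m 0 0))%:C%C *: expH beta X - @ket0 R).
  have -> : expH beta X = rdiag (\row_i expR (- beta * qubit_energy m 0 i)).
    exact: expH_qubit.
  suff -> : @ket0 R = rdiag (\row_i (i == 0)%:R).
    rewrite -rdiagZ -rdiagB.
    have := @psd_rdiag _ _ 1%:M (expR (beta * qubit_energy m 0 0) *:
      \row_i expR (- beta * qubit_energy m 0 i) - \row_i (i == 0)%:R).
    rewrite mul1mx adj1 mulmx1; apply=> i; move: (qubit_energy m) => h; rewrite !mxE.
    case: (i =P 0) => [->|_]; last by rewrite subr0 mulr_ge0 ?expR_ge0.
    by rewrite -expRD mulNr subrr expR0 subrr.
  apply/matrixP => i j; rewrite rdiagE !mxE.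
  case: (i =P j) => [->|]; first by rewrite andbb; case: eqP.
  by case: (i =P 0) => [->|] //; case: (j =P 0) => [->|].
(* [w <= 1 <= e^{beta b} e^{-beta H}], since no eigenvalue of [H] exceeds [b]. *)
have pR : psd ((expR (beta * b))%:C%C *: expH beta Rs - w).
  rewrite -[X in X - w](subrK 1%:M) -addrA.
  apply: psdD; last exact: psd_1B_density.
  rewrite (expHE _ UU UU' eR).
  have -> : (expR (beta * b))%:C%C *: (U *m rdiag (\row_i expR (- beta * d 0 i)) *m adj U) - 1%:M
    = U *m rdiag (expR (beta * b) *: (\row_i expR (- beta * d 0 i)) - const_mx 1) *m adj U.
    by rewrite rdiagB rdiag1 rdiagZ mulmxBr mulmxBl mulmx1 UU' -scalemxAr -scalemxAl.
  apply: psd_rdiag => i; rewrite !mxE -expRD subr_ge0 -expR0 ler_expR mulNr -mulrBr.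
  rewrite mulr_ge0 ?(ltW b0) // subr_ge0; apply: (@opnorm_le_spectrum _ U) => //.
  by rewrite -eR.
have dom : psd (k%:C%C *: expH beta (sys_prod X Rs) - rho).
  exact: (psd_expH_tensB vX vR (expR_ge0 _) pk0 pX pR).
pose K := k * partition_fun beta (sys_prod X Rs) / partition_fun beta B *
   complex.Re ((adj v *m expH beta B *m v) 0 0).
have qE : (adj v *m expH beta B *m v) 0 0 =
   (complex.Re ((adj v *m expH beta B *m v) 0 0))%:C%C.
  by rewrite RRe_real // ger0_real //; apply: (psd_expH beta vB).2.
have prho : psd rho := psd_tens pk0 dw.1.
have hT j : hermitian (T j rho).
  have [E' [A' [V [[vE vA'] _ _ fE]]]] := thT j.
  suff : psd (T j rho) by case.
  rewrite fE; exact: (psd_ptrace2 (psd_conj V (psd_tens prho (psd_gibbs beta vE)))).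
have qT j : (adj v *m T j rho *m v) 0 0 <= K%:C%C.
  rewrite /K rmorphM /= -qE; exact: (thermal_op_dominated v (thT j) vP vB ZB k0 dom).
have [hM qM] := psd_quad_limit (cT rho) hT qT.
have hsM : hermitian (sigma - E rho) by rewrite /hermitian adjB hs hM.
have := quad_le_tnorm hsM v1; rewrite lecE => /andP[_ /=].
rewrite mulmxBr mulmxBl mxBE raddfB /= => h1.
have h2 : tnorm (sigma - E rho) <= 2 * e.
  by move: dE; rewrite -ltr_pdivlMl // invrK => /ltW.
have h3 : K <= m * (sdim Rs)%:R * expR (beta * b) *
    ((partition_fun beta B)^-1 * complex.Re ((adj v *m expH beta B *m v) 0 0)).
  rewrite /K mulrA ler_wpM2r //; first by have := (psd_expH beta vB).2 v; rewrite qE ler0c.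
  rewrite ler_wpM2r ?invr_ge0 ?(ltW ZB) // partition_fun_prod // /k.
  rewrite -[m in leRHS](partition_fun_qubit b0 m1) -/X.
  set q := expR (beta * qubit_energy m 0 0); set zX := partition_fun beta X.
  rewrite [leLHS](_ : _ = q * zX * partition_fun beta Rs * expR (beta * b)); last by ring.
  rewrite ler_wpM2r ?expR_ge0 // ler_wpM2l ?mulr_ge0 ?expR_ge0 ?partition_fun_ge0 //.
  (* Energies are nonnegative, so the partition function of the reference is at most its
     dimension. *)
  rewrite (partition_funE _ UU UU' eR).
  rewrite -[X in _ <= X%:R]card_ord -sum1_card natr_sum ler_sum // => i _.
  by rewrite -[leRHS]expR0 ler_expR mulNr oppr_le0 mulr_ge0 // ltW.
rewrite -[leLHS](subrK (complex.Re ((adj v *m E rho *m v) 0 0))).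
exact: lerD (le_trans h1 h2) (le_trans qM h3).
Qed.

End Converse.

(** * Energy-conserving preparation *)

Section PartialSwap.
Context {R : realType}.
Local Notation C := R[i].

(* Exchanges initial and final space of a partial isometry [q] with [q^2 = 0] and fixes
   their orthogonal complement. *)
Definition partial_swap n (q : 'M[C]_n) : 'M[C]_n :=
  1%:M + (q + adj q) - (q *m adj q + adj q *m q).

Lemma adj_partial_swap n (q : 'M[C]_n) : adj (partial_swap q) = partial_swap q.
Proof.
by rewrite /partial_swap adjB !adjD adj1 !adjM !adjK [adj q + q]addrC.
Qed.

(** With [c = q + q^*] and [e = q q^* + q^* q], the hypotheses give [c^2 = e] and [c e = e c = c];
    hence [(1 + c - e)^2 = 1]. *)
Lemma partial_swapK n (q : 'M[C]_n) : q *m q = 0 -> q *m adj q *m q = q ->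
  partial_swap q *m partial_swap q = 1%:M.
Proof.
move=> qq qaq; rewrite /partial_swap; set c := q + adj q; set e := _ + adj q *m q.
have aa : adj q *m adj q = 0 by rewrite -adjM qq adj0.
have aqa : adj q *m q *m adj q = adj q.
  by have := congr1 (@adj R n n) qaq; rewrite !adjM adjK mulmxA.
have cc : c *m c = e.
  by rewrite mulmxDl !mulmxDr qq aa add0r addr0.
have ce : c *m e = c.
  rewrite /e mulmxDr !mulmxDl !mulmxA qq aa qaq aqa !mul0mx add0r addr0.
  by rewrite addrC.
have ec : e *m c = c by rewrite -cc -mulmxA cc.
have ee : e *m e = e by rewrite -{1}cc -mulmxA ce.
set u := 1%:M + c - e.
have uc : u *m c = e by rewrite mulmxBl mulmxDl mul1mx cc ec addrC addKr.
have ue : u *m e = c by rewrite mulmxBl mulmxDl mul1mx ce ee addrC addKr.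
by rewrite {2}/u mulmxBr mulmxDr mulmx1 uc ue /u subrK addrK.
Qed.

Lemma partial_swap_comm n (q H : 'M[C]_n) : hermitian H ->
  q *m H = H *m q -> partial_swap q *m H = H *m partial_swap q.
Proof.
move=> hH qH; have aH : adj q *m H = H *m adj q.
  by rewrite -{1}hH -adjM -qH adjM hH.
rewrite /partial_swap mulmxBl mulmxBr !mulmxDl !mulmxDr mul1mx mulmx1 qH aH.
by rewrite -!mulmxA qH aH !mulmxA qH aH.
Qed.

Lemma partial_swap_act n k (q : 'M[C]_n) (x : 'M[C]_(n, k)) : q *m q = 0 ->
  adj q *m q *m x = x -> partial_swap q *m x = q *m x.
Proof.
move=> qq qx.
have ax : adj q *m x = 0.
  by rewrite -qx !mulmxA -adjM qq adj0 !mul0mx.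
rewrite /partial_swap mulmxBl !mulmxDl mul1mx qx -[q *m adj q *m x]mulmxA ax.
by rewrite mulmx0 add0r addr0 addrC addKr.
Qed.

End PartialSwap.

(** * Matrices of partial injections *)

Section PartialInjection.
Context {R : realType}.
Local Notation C := R[i].

(** Partial maps occur because a full bath cannot take another letter; permutations are the case
    [Some \o s]. *)
Definition pfun_mx m n (w : 'I_n -> option 'I_m) : 'M[C]_(m, n) :=
  \matrix_(i, j) (w j == Some i)%:R.

Definition pinjective m n (w : 'I_n -> option 'I_m) :=
  forall i j t, w i = Some t -> w j = Some t -> i = j.

Lemma adj_pfun_mulE m n k (w : 'I_n -> option 'I_m) (M : 'M[C]_(m, k)) i j :
  (adj (pfun_mx w) *m M) i j = if w i is Some t then M t j else 0.
Proof.
rewrite mxE; case ew: (w i) => [t|]; last first.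
  by rewrite big1 // => l _; rewrite adjE mxE ew rmorph0 mul0r.
rewrite (bigD1 t) //= big1 ?addr0; last first.
  move=> l /negPf lt; rewrite adjE mxE ew (inj_eq (@Some_inj _)) eq_sym lt.
  by rewrite rmorph0 mul0r.
by rewrite adjE mxE ew eqxx rmorph1 mul1r.
Qed.

Lemma adj_pfun_mul m n (w : 'I_n -> option 'I_m) : pinjective w ->
  adj (pfun_mx w) *m pfun_mx w = rdiag (\row_j (isSome (w j))%:R).
Proof.
move=> wI; apply/matrixP => i j; rewrite adj_pfun_mulE rdiagE mxE.
case ew: (w i) => [t|] /=; last by rewrite rmorph0; case: ifP.
rewrite mxE; have [<-|ij] := eqVneq i j; first by rewrite ew eqxx rmorph1.
by case: eqP => // /(wI _ _ _ ew) /eqP; rewrite (negPf ij).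
Qed.

Lemma pfun_mx_partial_isometry m n (w : 'I_n -> option 'I_m) : pinjective w ->
  pfun_mx w *m adj (pfun_mx w) *m pfun_mx w = pfun_mx w.
Proof.
move=> wI; rewrite -mulmxA adj_pfun_mul //; apply/matrixP => i j.
rewrite mul_rdiagE !mxE; case: eqP => [->|_]; rewrite ?mul0r //.
by rewrite rmorph1 mulr1.
Qed.

(** [w] lowers every energy by the constant [c], so its matrix intertwines the two diagonal
    Hamiltonians up to that shift. *)
Lemma pfun_mx_rdiag m n (w : 'I_n -> option 'I_m) (d : 'rV[R]_n) (e : 'rV[R]_m) c :
  (forall j t, w j = Some t -> e 0 t = d 0 j - c) ->
  pfun_mx w *m rdiag d = rdiag e *m pfun_mx w + c%:C%C *: pfun_mx w.
Proof.
move=> h; apply/matrixP => i j; rewrite mul_rdiagE [in RHS]mxE rdiag_mulE !mxE.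
case: eqP => [/h ->|]; rewrite ?mulr0 ?mul0r ?addr0 // mul1r !mulr1 -rmorphD.
by rewrite subrK.
Qed.

Lemma adj_pfun_can m n (s : 'I_n -> 'I_m) (t : 'I_m -> 'I_n) :
  cancel s t -> cancel t s ->
  adj (pfun_mx (Some \o s)) = pfun_mx (Some \o t).
Proof.
move=> st ts; apply/matrixP => i j; rewrite adjE !mxE rmorph_nat /=.
by rewrite !(inj_eq (@Some_inj _)) (can2_eq st ts) eq_sym.
Qed.

Lemma unitary_pfun m n (s : 'I_n -> 'I_m) (t : 'I_m -> 'I_n) :
  cancel s t -> cancel t s ->
  adj (pfun_mx (Some \o s)) *m pfun_mx (Some \o s) = 1%:M.
Proof.
move=> st ts; rewrite adj_pfun_mul; last first.
  by move=> i j k [<-] [] /(can_inj st).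
by rewrite -rdiag1; congr rdiag; apply/rowP => i; rewrite !mxE.
Qed.

End PartialInjection.

(** * Thermal operations from partial isometries *)

Section Preparation.
Context {R : realType} (beta : R).
Local Notation C := R[i].

(** [T] prepares the target and [W] acts on the environment so that [T (x) W] conserves energy; [Sw]
    is an energy-conserving unitary between the same spaces. The partial swap of [q = Sw^* Q], with
    [Q = T (x) W], extends this partial isometry to a unitary. On the part of the Gibbs state in the
    initial space of [W], of weight [g], the outcome is [T Z T^*]; all else is collected in [N],
    whose trace is known because [f] preserves traces. *)
Lemma thermal_op_prepare (P B E A' : system R)
    (Sw : 'M[C]_(sdim B * sdim A', sdim P * sdim E))
    (T : 'M[C]_(sdim B, sdim P)) (W : 'M[C]_(sdim A', sdim E)) (g : R) :
  valid_sys P -> valid_sys E -> valid_sys A' -> \tr (gibbs beta E) = 1 ->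
  adj Sw *m Sw = 1%:M -> Sw *m adj Sw = 1%:M ->
  Sw *m sham (sys_prod P E) = sham (sys_prod B A') *m Sw ->
  (T *t W) *m sham (sys_prod P E) = sham (sys_prod B A') *m (T *t W) ->
  T *m adj T *m T = T -> W *m adj W *m W = W ->
  (T *t W) *m (adj Sw *m (T *t W)) = 0 ->
  adj W *m W *m gibbs beta E = gibbs beta E *m (adj W *m W) ->
  \tr (adj W *m W *m gibbs beta E) = g%:C%C ->
  exists f, thermal_op beta f /\ forall Z Y : 'M[C]_(sdim P),
    psd Z -> psd Y -> adj T *m T *m Z = Z ->
    exists N, [/\ psd N, f (Z + Y) = g%:C%C *: (T *m Z *m adj T) + N &
      \tr N = \tr Z + \tr Y - g%:C%C * \tr Z].
Proof.
move=> vP vE vA' trE SS SS' cS cQ TTT WWW QSQ GW gE.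
set Q := T *t W in cQ QSQ.
pose q := adj Sw *m Q; pose V := Sw *m partial_swap q.
have eQ : Sw *m q = Q by rewrite /q mulmxA SS' mul1mx.
have qaq : adj q *m q = adj Q *m Q.
  by rewrite /q adjM adjK !mulmxA -[_ *m Sw *m _]mulmxA SS' mulmx1.
have QQQ : Q *m adj Q *m Q = Q by rewrite /Q adj_tens !tensmx_mul TTT WWW.
have qq : q *m q = 0 by rewrite {1}/q -mulmxA QSQ mulmx0.
have qqq : q *m adj q *m q = q.
  by rewrite -mulmxA qaq /q -!mulmxA [Q *m _]mulmxA QQQ.
have UU := partial_swapK qq qqq.
have aU := adj_partial_swap q.
have VV : adj V *m V = 1%:M.
  by rewrite /V adjM !mulmxA -[_ *m adj Sw *m Sw]mulmxA SS mulmx1 aU UU.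
have VV' : V *m adj V = 1%:M.
  by rewrite /V adjM !mulmxA -[_ *m partial_swap q *m _]mulmxA aU UU mulmx1 SS'.
have hPE : hermitian (sham (sys_prod P E)) := (valid_sys_prod vP vE).1.
have cS' : adj Sw *m sham (sys_prod B A') = sham (sys_prod P E) *m adj Sw.
  rewrite -[LHS]mulmx1 -SS' mulmxA -[adj Sw *m _ *m Sw]mulmxA -cS !mulmxA SS.
  by rewrite mul1mx.
have cV : V *m sham (sys_prod P E) = sham (sys_prod B A') *m V.
  have cq : q *m sham (sys_prod P E) = sham (sys_prod P E) *m q.
    by rewrite /q -mulmxA cQ mulmxA cS' mulmxA.
  have cU : partial_swap q *m sham (sys_prod P E) = sham (sys_prod P E) *m partial_swap q.
    exact: partial_swap_comm.
  by rewrite /V -mulmxA cU !mulmxA cS.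
pose f (rho : 'M[C]_(sdim P)) : 'M[C]_(sdim B) :=
  ptrace2 (V *m (rho *t gibbs beta E) *m adj V).
exists f; split; first by exists E, A', V; split.
move=> Z Y pZ pY TZ; set G := gibbs beta E in GW gE trE *.
have pG : psd G := psd_gibbs beta vE.
set Pi := adj W *m W in GW gE.
have aPi : adj Pi = Pi by rewrite /Pi adjM adjK.
have PiPi : Pi *m Pi = Pi by rewrite {1}/Pi -mulmxA [W *m _]mulmxA WWW.
(* The Gibbs state splits along the projection [Pi], with which it commutes: [W] succeeds on [G1]
   and fails on [G2]. *)
pose G1 := Pi *m G *m adj Pi; pose G2 := (1%:M - Pi) *m G *m adj (1%:M - Pi).
have G1E : G1 = Pi *m G by rewrite /G1 aPi -mulmxA -GW mulmxA PiPi.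
have eG : G = G1 + G2.
  rewrite /G2 adjB adj1 aPi mulmxBl mul1mx mulmxBr mulmx1 mulmxBl -GW.
  by rewrite -[Pi *m G *m Pi]mulmxA -GW mulmxA PiPi subrr subr0 G1E addrC subrK.
have pG1 : psd G1 := psd_conj _ pG.
have pG2 : psd G2 := psd_conj _ pG.
pose x := Z *t G1.
have Vx : V *m x = Q *m x.
  have qx : adj q *m q *m x = x.
    by rewrite qaq /Q /x adj_tens !tensmx_mul TZ -/Pi G1E mulmxA PiPi.
  by rewrite /V -mulmxA (partial_swap_act qq qx) mulmxA eQ.
have hx : adj x = x by rewrite /x adj_tens pZ.1 pG1.1.
have VxV : V *m x *m adj V = (T *m Z *m adj T) *t (W *m G1 *m adj W).
  have -> : V *m x *m adj V = Q *m x *m adj Q.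
    rewrite Vx -!mulmxA; congr (_ *m _).
    by rewrite -{1}hx -adjM Vx adjM hx.
  by rewrite /Q /x adj_tens !tensmx_mul.
have trW : \tr (W *m G1 *m adj W) = g%:C%C.
  by rewrite mxtrace_mulC mulmxA -/Pi G1E mulmxA PiPi.
have trV (M : 'M[C]_(sdim P * sdim E)) : \tr (ptrace2 (V *m M *m adj V)) = \tr M.
  by rewrite tr_ptrace2 mxtrace_mulC mulmxA VV mul1mx.
exists (ptrace2 (V *m (Z *t G2 + Y *t G) *m adj V)).
have fE : f (Z + Y) = g%:C%C *: (T *m Z *m adj T) +
    ptrace2 (V *m (Z *t G2 + Y *t G) *m adj V).
  rewrite /f -/G tensmxDl {1}eG tensmxDr -addrA mulmxDr mulmxDl ptrace2D.
  by rewrite -/x VxV ptrace2_tens trW.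
split=> //.
  by apply/psd_ptrace2/psd_conj/psdD; apply: psd_tens.
have := congr1 mxtrace fE; rewrite /f trV tr_tens trE mulr1 !mxtraceD mxtraceZ.
have -> : \tr (T *m Z *m adj T) = \tr Z by rewrite mxtrace_mulC mulmxA TZ.
by move=> ->; rewrite [RHS]addrC addKr.
Qed.

End Preparation.

(** * Environment made of a thermal copy and a bath *)

Section DiagonalPreparation.
Context {R : realType} (beta : R).
Local Notation C := R[i].

Lemma gibbs_rdiag n (d : 'rV[R]_n) : (forall i, 0 <= d 0 i) ->
  gibbs beta (Sys (rdiag d)) =
  rdiag (\row_i ((\sum_j expR (- beta * d 0 j))^-1 * expR (- beta * d 0 i))).
Proof.
move=> d0; rewrite (gibbsE beta (valid_rdiag d0)) partition_fun_rdiag expH_rdiag.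
by rewrite -rdiagZ; congr rdiag; apply/rowP => i; rewrite !mxE.
Qed.

(** The environment is [B (x) S] and the discarded system [P (x) S]; exchanging the first two
    factors turns [P (x) (B (x) S)] into [B (x) (P (x) S)]. *)
Definition swap12 a b c (k : 'I_(a * (b * c))) : 'I_(b * (a * c)) :=
  mxtens_index ((mxtens_unindex (mxtens_unindex k).2).1,
    mxtens_index ((mxtens_unindex k).1, (mxtens_unindex (mxtens_unindex k).2).2)).

Lemma swap12E a b c (i : 'I_a) (j : 'I_b) (l : 'I_c) :
  swap12 (mxtens_index (i, mxtens_index (j, l))) =
  mxtens_index (j, mxtens_index (i, l)).
Proof.
by rewrite /swap12 mxtens_indexK; cbn [fst snd]; rewrite mxtens_indexK.
Qed.

Lemma swap12K a b c : cancel (@swap12 a b c) (@swap12 b a c).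
Proof.
move=> k; case: (mxtens_indexP k) => i k'; case: (mxtens_indexP k') => j l.
by rewrite !swap12E.
Qed.

Definition total_weight m n (h : 'rV[R]_m) (e : 'rV[R]_n) (D : 'I_m -> 'I_n -> bool) : R :=
  \sum_b \sum_(s | D b s) expR (- beta * (h 0 b + e 0 s)).

(** The environment is a thermal copy of [B] next to the bath. [W] lets the bath absorb the letter
    [b] and leaves the register of [P] in level [p1]; it succeeds with the Gibbs probability that
    [w] is defined. The energy [g] gained by [T] is exactly what [W] gives up. *)
Lemma thermal_op_prepare_diag (P B : system R) (eP : 'rV[R]_(sdim P))
    (hB : 'rV[R]_(sdim B)) (U : 'M[C]_(sdim B)) (dS : nat) (eS : 'rV[R]_dS)
    (T : 'M[C]_(sdim B, sdim P)) (w : 'I_(sdim B) -> 'I_dS -> option 'I_dS)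
    (p1 : 'I_(sdim P)) (g : R)
    (good := total_weight hB eS (fun b s => isSome (w b s)))
    (all := total_weight hB eS (fun _ _ => true)) :
  (forall i, 0 <= eP 0 i) -> (forall i, 0 <= hB 0 i) -> (forall i, 0 <= eS 0 i) ->
  sham P = rdiag eP -> unitary U -> sham B = U *m rdiag hB *m adj U ->
  T *m adj T *m T = T -> sham B *m T = T *m sham P + g%:C%C *: T ->
  (forall b, T b p1 = 0) ->
  (forall b s b' s' t, w b s = Some t -> w b' s' = Some t -> b = b' /\ s = s') ->
  (forall b s t, w b s = Some t -> eP 0 p1 + eS 0 t = hB 0 b + eS 0 s - g) ->
  0 < all ->
  exists f, thermal_op beta f /\ forall Z Y : 'M[C]_(sdim P),
    psd Z -> psd Y -> adj T *m T *m Z = Z ->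
    exists N, [/\ psd N, f (Z + Y) = (all^-1 * good)%:C%C *: (T *m Z *m adj T) + N &
      \tr N = \tr Z + \tr Y - (all^-1 * good)%:C%C * \tr Z].
Proof.
move=> eP0 hB0 eS0 hPE [UU UU'] eqB TTT TH Tp1 wI wE all0.
pose eE : 'rV[R]_(sdim B * dS) := \row_k (hB 0 (mxtens_unindex k).1 + eS 0 (mxtens_unindex k).2).
pose eA : 'rV[R]_(sdim P * dS) := \row_k (eP 0 (mxtens_unindex k).1 + eS 0 (mxtens_unindex k).2).
have eE0 i : 0 <= eE 0 i by rewrite mxE addr_ge0.
have eA0 i : 0 <= eA 0 i by rewrite mxE addr_ge0.
pose w' (k : 'I_(sdim B * dS)) : option 'I_(sdim P * dS) :=
  omap (fun t => mxtens_index (p1, t)) (w (mxtens_unindex k).1 (mxtens_unindex k).2).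
have w'I : pinjective w'.
  move=> i j t; case: (mxtens_indexP i) => b s; case: (mxtens_indexP j) => b' s'.
  rewrite /w' !mxtens_indexK /=.
  case e1: (w b s) => [x|] //= [<-]; case e2: (w b' s') => [y|] //= /Some_inj/mxtens_index_inj[yx].
  by rewrite yx in e2; have [-> ->] := wI _ _ _ _ _ e1 e2.
pose E := Sys (rdiag eE); pose A' := Sys (rdiag eA).
pose W : 'M[C]_(sdim A', sdim E) := pfun_mx w'.
pose sw : 'I_(sdim P * (sdim B * dS)) -> 'I_(sdim B * (sdim P * dS)) :=
  @swap12 (sdim P) (sdim B) dS.
pose Sw0 : 'M[C]_(sdim B * sdim A', sdim P * sdim E) := pfun_mx (Some \o sw).
(* The environment copy of [B] is written in the energy basis, so [U] rotates it after the
   exchange. *)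
pose Sw : 'M[C]_(sdim B * sdim A', sdim P * sdim E) := (U *t 1%:M) *m Sw0.
have SS0 : adj Sw0 *m Sw0 = 1%:M.
  by apply: (unitary_pfun (@swap12K _ _ _) (@swap12K _ _ _)).
have SS0' : Sw0 *m adj Sw0 = 1%:M.
  rewrite /Sw0 (adj_pfun_can (@swap12K _ _ _) (@swap12K _ _ _)).
  rewrite -{1}[pfun_mx (Some \o sw)]adjK (adj_pfun_can (@swap12K _ _ _) (@swap12K _ _ _)).
  by apply: (unitary_pfun (@swap12K _ _ _) (@swap12K _ _ _)).
have VV : adj (U *t (1%:M : 'M[C]_(sdim A'))) *m (U *t 1%:M) = 1%:M.
  by rewrite adj_tens tensmx_mul UU adj1 mulmx1 tens11.
have VV' : (U *t 1%:M) *m adj (U *t (1%:M : 'M[C]_(sdim A'))) = 1%:M.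
  by rewrite adj_tens tensmx_mul UU' adj1 mulmx1 tens11.
pose x := \row_k (eP 0 (mxtens_unindex k).1 + eE 0 (mxtens_unindex k).2).
pose y := \row_k (hB 0 (mxtens_unindex k).1 + eA 0 (mxtens_unindex k).2).
have HPE : sham (sys_prod P E) = rdiag x.
  by rewrite /= hPE; exact: rdiag_tens_sum.
have HBA : sham (sys_prod B A') = (U *t 1%:M) *m rdiag y *m adj (U *t 1%:M).
  rewrite -rdiag_tens_sum adj_tens mulmxDr mulmxDl !tensmx_mul !mulmx1 UU'.
  by rewrite adj1 !mulmx1 mul1mx /= eqB.
have cSw0 : Sw0 *m rdiag x = rdiag y *m Sw0.
  rewrite /Sw0 (@pfun_mx_rdiag _ _ _ _ x y 0) ?scale0r ?addr0 // => k _ [<-].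
  case: (mxtens_indexP k) => p k'; case: (mxtens_indexP k') => b s.
  rewrite /sw swap12E !mxE !mxtens_indexK; cbn [fst snd].
  by rewrite subr0 addrCA.
have trG : \tr (gibbs beta E) = 1.
  rewrite gibbs_rdiag // tr_rdiag; under eq_bigr do rewrite mxE.
  rewrite -mulr_sumr mulVf ?rmorph1 //.
  rewrite sum_mxtens; apply: lt0r_neq0; apply: lt_le_trans all0 _; rewrite le_eqVlt.
  apply/orP; left; apply/eqP; apply: eq_bigr => b _; apply: eq_bigr => s _.
  by rewrite mxE mxtens_indexK.
have sumE : \sum_j expR (- beta * eE 0 j) = all.
  rewrite sum_mxtens; apply: eq_bigr => b _; apply: eq_bigr => s _.
  by rewrite mxE mxtens_indexK.
have WWE : adj W *m W = rdiag (\row_j (isSome (w' j))%:R) by exact: adj_pfun_mul.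
apply: (@thermal_op_prepare _ beta P B E A' Sw T W (all^-1 * good)).
- by rewrite /valid_sys hPE; exact: valid_rdiag.
- exact: valid_rdiag.
- exact: valid_rdiag.
- exact: trG.
- by rewrite /Sw adjM mulmxA -[_ *m adj _ *m _]mulmxA VV mulmx1.
- by rewrite /Sw adjM mulmxA -[_ *m Sw0 *m _]mulmxA SS0' mulmx1.
- rewrite HPE HBA /Sw -[LHS]mulmxA cSw0 [RHS]mulmxA -[_ *m adj _ *m _]mulmxA VV.
  by rewrite mulmx1 mulmxA.
- have WE : W *m sham E = sham A' *m W + g%:C%C *: W.
    apply: pfun_mx_rdiag => k t; case: (mxtens_indexP k) => b s.
    rewrite /w' mxtens_indexK; case ew: (w b s) => [z|] //= /Some_inj <-.
    by rewrite !mxE !mxtens_indexK; exact: wE ew.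
  rewrite /sys_prod /= mulmxDr mulmxDl !tensmx_mul !mulmx1 !mul1mx WE TH.
  rewrite tensmxDl tensmxDr tensmxZl tensmxZr -addrA; congr (_ + _).
  exact: addrC.
- exact: TTT.
- exact: pfun_mx_partial_isometry.
(* [W] leaves level [p1] in the register that the inverse exchange turns into the input of [T], and
   [T] vanishes on [p1]. *)
- apply/matrixP => i j; rewrite [RHS]mxE mxE big1 // => k _.
  rewrite /Sw adjM -mulmxA adj_tens adj1 tensmx_mul mul1mx adj_pfun_mulE /=.
  case: (mxtens_indexP k) => p k'; case: (mxtens_indexP k') => b s.
  case: (mxtens_indexP i) => i1 i2; case: (mxtens_indexP j) => j1 j2.
  rewrite /sw swap12E !tensmxE.
  have [->|pp] := eqVneq p p1; first by rewrite Tp1 !mul0r.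
  suff -> : W (mxtens_index (p, s)) j2 = 0 by rewrite !mulr0.
  rewrite mxE /w'; case: (w _ _) => [z|] //=; case: eqP => //.
  by move=> /Some_inj/mxtens_index_inj[] /esym/eqP; rewrite (negPf pp).
- by rewrite WWE gibbs_rdiag // !rdiagM; congr rdiag; apply/rowP => i; rewrite !mxE mulrC.
- rewrite WWE gibbs_rdiag // rdiagM tr_rdiag; congr (_%:C%C).
  rewrite sumE sum_mxtens mulr_sumr; apply: eq_bigr => b _.
  rewrite mulr_sumr [RHS]big_mkcond; apply: eq_bigr => s _.
  rewrite !mxE mxtens_indexK /w' mxtens_indexK /=.
  by case: (w b s) => [z|] /=; rewrite ?mul1r ?mul0r.
Qed.

End DiagonalPreparation.

(** * The bath of bounded lists *)

Section Bath.

(* Lists over [T] of length at most [K]. *)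
Fixpoint bath (T : finType) (K : nat) : finType :=
  if K is K'.+1 then option (T * bath T K')%type else unit.

Definition bath_nil (T : finType) K : bath T K :=
  if K is K'.+1 return bath T K then None else tt.

(* Undefined exactly on lists of length [K]. *)
Fixpoint bath_cons (T : finType) K : T -> bath T K -> option (bath T K) :=
  match K return T -> bath T K -> option (bath T K) with
  | 0 => fun _ _ => None
  | K'.+1 => fun b s =>
      if s is Some bs then omap (fun t => Some (b, t)) (bath_cons bs.1 bs.2)
      else Some (Some (b, bath_nil T K'))
  end.

Fixpoint bath_full (T : finType) K : bath T K -> bool :=
  match K return bath T K -> bool with
  | 0 => fun _ => true
  | K'.+1 => fun s => if s is Some bs then bath_full bs.2 else false
  end.

Lemma bath_cons_neq_nil (T : finType) K (b : T) (s : bath T K) :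
  bath_cons b s <> Some (bath_nil T K).
Proof. by case: K s => [|K] //= [[b' s']|] //=; case: bath_cons. Qed.

Lemma bath_cons_inj (T : finType) K (b b' : T) (s s' t : bath T K) :
  bath_cons b s = Some t -> bath_cons b' s' = Some t -> b = b' /\ s = s'.
Proof.
elim: K b b' s s' t => [|K IH] //= b b' [[c r]|] [[c' r']|] t /=.
- case e1: (bath_cons c r) => [x|] //= [<-]; case e2: (bath_cons c' r') => [y|] //= [-> yx].
  by rewrite yx in e2; have [-> ->] := IH _ _ _ _ _ e1 e2.
- case e1: (bath_cons c r) => [x|] //= [<-] [_ xE].
  by case: (@bath_cons_neq_nil _ _ c r); rewrite e1 xE.
- move=> [<-]; case e1: (bath_cons c' r') => [x|] //= [_ xE].
  by case: (@bath_cons_neq_nil _ _ c' r'); rewrite e1 xE.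
- by move=> [<-] [->].
Qed.

Lemma bath_consP (T : finType) K (b : T) (s : bath T K) :
  isSome (bath_cons b s) = ~~ bath_full s.
Proof.
elim: K b s => [|K IH] //= b [[c r]|] //=; rewrite -(IH c).
by case: bath_cons.
Qed.

Lemma sum_option (V : nmodType) (T : finType) (P : pred (option T)) (F : option T -> V) :
  \sum_(x | P x) F x = (if P None then F None else 0) + \sum_(x | P (Some x)) F (Some x).
Proof.
rewrite [LHS]big_mkcond (bigD1 None) //=; congr (_ + _).
rewrite (reindex_omap Some id) //=; last by case.
rewrite [RHS]big_mkcond /=; apply: eq_big => // x.
by rewrite eqxx.
Qed.

Context {R : realType} (beta : R) (T : finType) (h : T -> R) (F : R).

Fixpoint bath_energy K : bath T K -> R :=
  match K return bath T K -> R with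
  | 0 => fun _ => 0
  | K'.+1 => fun s => if s is Some bs then h bs.1 + F + bath_energy bs.2 else 0
  end.

Lemma bath_energy_nil K : bath_energy (bath_nil T K) = 0.
Proof. by case: K. Qed.

Lemma bath_energy_cons K (b : T) (s t : bath T K) :
  bath_cons b s = Some t -> bath_energy t = h b + F + bath_energy s.
Proof.
elim: K b s t => [|K IH] //= b [[c r]|] t /=.
  by case e1: (bath_cons c r) => [x|] //= [<-] /=; rewrite (IH _ _ _ e1).
by move=> [<-] /=; rewrite bath_energy_nil addr0.
Qed.

Hypothesis norm1 : \sum_b expR (- beta * (h b + F)) = 1.

(** By [norm1] the lists of each fixed length have total weight 1, and there are [K + 1] lengths. *)
Lemma bath_partition K : \sum_s expR (- beta * bath_energy (s : bath T K)) = K.+1%:R.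
Proof.
elim: K => [|K IH] /=; first by rewrite big_const /= card_unit /= mulr0 expR0 addr0.
rewrite sum_option /= mulr0 expR0 -[LHS]addrC -natr1; congr (_ + _).
rewrite -IH -[RHS]mul1r -norm1 mulr_suml
  -(pair_bigA _ (fun b s => expR (- beta * (h b + F + bath_energy s)))) /=.
apply: eq_bigr => b _; rewrite mulr_sumr; apply: eq_bigr => s _.
by rewrite mulrDr expRD.
Qed.

(** Full lists are those of length [K], a single one of the equally likely lengths. *)
Lemma bath_full_weight K :
  \sum_(s | bath_full s) expR (- beta * bath_energy (s : bath T K)) = 1.
Proof.
elim: K => [|K IH] /=; first by rewrite big_const /= card_unit /= mulr0 expR0 addr0.
rewrite sum_option /= add0r.
rewrite -[RHS]norm1 -(pair_big xpredT (fun s => bath_full s)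
  (fun b s => expR (- beta * (h b + F + bath_energy s)))) /=.
apply: eq_bigr => b _; rewrite -[RHS]mulr1 -IH mulr_sumr; apply: eq_bigr => s _.
by rewrite mulrDr expRD.
Qed.

End Bath.

Section BathExists.
Context {R : realType} (beta : R).

(** Puts the bath in matrix form, with ordinals for states. Absorption fails only on full lists, and
    the bath is independent of the thermal copy, so the failure probability is [1 / (K + 1)]. *)
Lemma bath_exists (d K : nat) (h : 'rV[R]_d) (F : R) :
  \sum_b expR (- beta * (h 0 b + F)) = 1 ->
  exists (dS : nat) (eS : 'rV[R]_dS) (w : 'I_d -> 'I_dS -> option 'I_dS),
  [/\ (forall s, 0 <= eS 0 s),
      (forall b s b' s' t, w b s = Some t -> w b' s' = Some t -> b = b' /\ s = s'),
      (forall b s t, w b s = Some t -> eS 0 t = h 0 b + F + eS 0 s),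
      0 < total_weight beta h eS (fun _ _ => true) &
      (total_weight beta h eS (fun _ _ => true))^-1 *
        total_weight beta h eS (fun b s => isSome (w b s)) = 1 - K.+1%:R^-1].
Proof.
move=> norm1; pose S := bath 'I_d K; pose en (s : S) := bath_energy (fun b => h 0 b) F s.
(* [F] can be negative, and so can the energies [en]. Adding the constant [c] makes them nonnegative
   and cancels both in differences and in the quotient of weights. *)
pose c := \sum_s `|en s|.
pose eS : 'rV[R]_#|S| := \row_i (en (enum_val i) + c).
pose w (b : 'I_d) (i : 'I_#|S|) := omap (fun t => enum_rank t : 'I_#|S|) (bath_cons b (enum_val i)).
have sumS (P : pred S) : \sum_(i : 'I_#|S| | P (enum_val i)) expR (- beta * eS 0 i) =
    expR (- beta * c) * \sum_(s | P s) expR (- beta * en s).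
  rewrite mulr_sumr (reindex (@enum_rank S)) /=; last first.
    by exists enum_val => i _; rewrite (enum_valK, enum_rankK).
  apply: eq_big => [s|s _]; first by rewrite enum_rankK.
  by rewrite mxE enum_rankK -expRD -mulrDr addrC.
have ec0 : 0 < expR (- beta * c) by exact: expR_gt0.
pose Zh := \sum_b expR (- beta * h 0 b).
have Zh0 : 0 < Zh.
  rewrite lt_neqAle eq_sym sumr_ge0 ?andbT; last by move=> b _; exact: expR_ge0.
  apply/eqP => Z0; have /eqP := norm1.
  under eq_bigr do rewrite mulrDr expRD.
  by rewrite -mulr_suml -/Zh Z0 mul0r eq_sym oner_eq0.
have split_weight (P : pred S) : total_weight beta h eS (fun _ i => P (enum_val i)) =
    Zh * (expR (- beta * c) * \sum_(s | P s) expR (- beta * en s)).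
  rewrite -sumS mulr_suml; apply: eq_bigr => b _; rewrite mulr_sumr.
  by apply: eq_bigr => s _; rewrite mulrDr expRD.
have allE : total_weight beta h eS (fun _ _ => true) = Zh * (expR (- beta * c) * K.+1%:R).
  by rewrite (split_weight xpredT) bath_partition.
have goodE : total_weight beta h eS (fun b s => isSome (w b s)) =
    Zh * (expR (- beta * c) * (K.+1%:R - 1)).
  have -> : K.+1%:R - 1 = \sum_(s | ~~ bath_full s) expR (- beta * en s).
    rewrite -(bath_partition norm1 K) (bigID (@bath_full _ K)) /=.
    by rewrite (bath_full_weight norm1) [LHS]addrC addKr.
  rewrite -split_weight; apply: eq_bigr => b _; apply: eq_bigl => s.
  by rewrite /w -(bath_consP b); case: bath_cons.
have K0 : (K.+1%:R : R) != 0 by rewrite pnatr_eq0.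
exists #|S|, eS, w; split.
- move=> s; rewrite mxE /c (bigD1 (enum_val s)) //= addrA addr_ge0 ?sumr_ge0 //.
  by rewrite -lerBlDl sub0r -normrN ler_norm.
- move=> b s b' s' t; rewrite /w.
  case e1: (bath_cons b _) => [x|] //= /Some_inj <-.
  case e2: (bath_cons b' _) => [y|] //= /Some_inj/enum_rank_inj yx.
  by rewrite yx in e2; have [-> /enum_val_inj ->] := bath_cons_inj e1 e2.
- move=> b s t; rewrite /w; case e1: (bath_cons b _) => [x|] //= /Some_inj <-.
  by rewrite !mxE enum_rankK /en (bath_energy_cons _ _ e1) addrA.
- by rewrite allE !mulr_gt0.
- rewrite allE goodE; field.
  by rewrite !gt_eqF // ltr0n.
Qed.

End BathExists.

(** * The reference system indexed by types *)

Section Reference.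
Context {R : realType}.
Local Notation C := R[i].

Definition type_energy d n (h : 'rV[R]_d) (t : {ffun 'I_d -> 'I_n.+1}) : R :=
  \sum_i (t i)%:R * h 0 i.

Definition typical d n (h : 'rV[R]_d) (mu win : R) (t : {ffun 'I_d -> 'I_n.+1}) : bool :=
  `|type_energy h t - n%:R * mu| <= win.

(** Energies are counted from the lower end [n mu - win] of the window, hence lie between 0 and
    [2 win]; types outside the window do not enter [refvec] and get energy 0. *)
Definition ref_energy d n (h : 'rV[R]_d) (mu win : R) : 'rV[R]_#|{ffun 'I_d -> 'I_n.+1}| :=
  \row_i (if typical h mu win (enum_val i)
          then type_energy h (enum_val i) - (n%:R * mu - win) else 0).

Definition ref_system d (h : 'rV[R]_d) (mu win : R) (n : nat) : system R :=
  Sys (rdiag (ref_energy n h mu win)).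

Lemma ref_energy_bound d n (h : 'rV[R]_d) mu win i : 0 <= win ->
  0 <= ref_energy n h mu win 0 i <= 2 * win.
Proof.
move=> win0; rewrite mxE /typical; case: ifP => [|_]; last by rewrite lexx mulr_ge0.
by rewrite ler_norml => /andP[h1 h2]; apply/andP; split; lra.
Qed.

Lemma opnorm_le_rdiag n (d : 'rV[R]_n) (b : R) : (forall i, 0 <= d 0 i <= b) ->
  0 <= b -> opnorm_le (rdiag d) b.
Proof.
move=> db b0 v; rewrite /vnorm -[b in leRHS](ger0_norm b0) -sqrtr_sqr.
rewrite -sqrtrM ?sqr_ge0 // ler_wsqrtr // mulr_sumr ler_sum // => i _.
suff : csq ((rdiag d *m v) i 0) <= b ^+ 2 * csq (v i 0) by [].
rewrite rdiag_mulE csqM csqR ler_wpM2r ?csq_ge0 // lerXn2r ?nnegrE //; by case/andP: (db i).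
Qed.

End Reference.

(** * One-shot preparation of the tensor power *)

Section OneShot.
Context {R : realType} (beta : R) (A : system R) (psi : 'M[R[i]]_(sdim A))
  (h : 'rV[R]_(sdim A)) (Z mu var : R) (n : nat)
  (ps : pow_spectrum psi h beta Z mu var n) (win : R).
Local Notation C := R[i].
Local Notation TT := {ffun 'I_(sdim A) -> 'I_n.+1}.
Local Notation dR := #|{: TT}|.
Local Notation dB := (sdim (sys_pow A n)).
Local Notation a := (psa ps).
Local Notation eR := (ref_energy n h mu win).

Let tyr (x : 'I_dB) : 'I_dR := enum_rank (psty ps x).
Let typ (r : 'I_dR) : bool := typical h mu win (enum_val r).
Let pr (r : 'I_dR) : R := \sum_(x | tyr x == r) csq (a x 0).
Let atyp : 'cV[C]_dB := \col_x (if typ (tyr x) then a x 0 else 0).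
(** An arbitrary level: it carries the weight missing from [refvec] and is where the reference ends
    up after a successful preparation. *)
Let r0 : 'I_dR := enum_rank [ffun=> ord0].

(* Sends [|0>|t>] to the normalised type-[t] component of [psi^{(x) n}]; when that
   component vanishes, division by zero makes the column zero. *)
Definition prep_mx : 'M[C]_(dB, 2 * dR) :=
  \matrix_(x, k) (if [&& (mxtens_unindex k).1 == 0, tyr x == (mxtens_unindex k).2 &
                         typ (tyr x)]
                  then a x 0 / (Num.sqrt (pr (tyr x)))%:C%C else 0).

(** The vector [|0> (x) refvec], written entrywise so that its width is 1 rather than [1 * 1]. *)
Let zeta : 'cV[C]_(2 * dR) :=
  \col_k (if ((mxtens_unindex k).1 == 0) && typ (mxtens_unindex k).2
          then (Num.sqrt (pr (mxtens_unindex k).2))%:C%C else 0).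

(** Indicator of the initial space of [prep_mx]; types of probability 0 are left out since their
    columns vanish. *)
Let supp : 'rV[R]_(2 * dR) :=
  \row_k [&& (mxtens_unindex k).1 == 0, typ (mxtens_unindex k).2 &
             pr (mxtens_unindex k).2 != 0]%:R.

Let refvec : 'cV[C]_dR := \col_r (if typ r then (Num.sqrt (pr r))%:C%C else 0).

Lemma pr_ge0 r : 0 <= pr r.
Proof. by apply: sumr_ge0 => x _; exact: csq_ge0. Qed.

Lemma pr_eq0 x : pr (tyr x) = 0 -> a x 0 = 0.
Proof.
move=> p0; apply: csq_eq0; apply/eqP; rewrite eq_le csq_ge0 andbT -p0.
by rewrite /pr (bigD1 x) //= lerDl sumr_ge0 // => y _; exact: csq_ge0.
Qed.

Lemma prep_mx_neq0 x k : prep_mx x k != 0 -> k = mxtens_index (0, tyr x).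
Proof.
rewrite mxE; case: ifP => [/and3P[/eqP c0 /eqP -> _] _|]; last by rewrite eqxx.
by rewrite -[k in LHS]mxtens_unindexK -c0; case: mxtens_unindex.
Qed.

(** Columns of different types have disjoint supports, and each typical one is normalised unless its
    type has probability 0. *)
Lemma prep_mx_gram : adj prep_mx *m prep_mx = rdiag supp.
Proof.
apply/matrixP => k k'; rewrite rdiagE [LHS]mxE [supp 0 k]mxE.
have [<-|kk'] := eqVneq k k'; last first.
  rewrite big1 // => x _; rewrite adjE.
  have [->|/prep_mx_neq0 ek] := eqVneq (prep_mx x k) 0; first by rewrite rmorph0 mul0r.
  have [->|/prep_mx_neq0 ek'] := eqVneq (prep_mx x k') 0; first by rewrite mulr0.
  by rewrite ek ek' eqxx in kk'.
under eq_bigr do rewrite adjE -csqE.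
rewrite -rmorph_sum; congr (_%:C%C).
case: (mxtens_indexP k) => c r; rewrite mxtens_indexK; cbn [fst snd].
have pE x : prep_mx x (mxtens_index (c, r)) = if [&& c == 0, tyr x == r & typ (tyr x)]
    then a x 0 / (Num.sqrt (pr (tyr x)))%:C%C else 0 by rewrite mxE mxtens_indexK.
under eq_bigr do rewrite pE.
case: (c == 0); last by apply: big1 => x _; rewrite csq0.
have [tr|tr] := boolP (typ r); last first.
  by apply: big1 => x _; case: (tyr x =P r) => [->|_]; rewrite ?(negPf tr) csq0.
rewrite (bigID (fun x => tyr x == r)) /= [X in _ + X]big1 ?addr0; last first.
  by move=> x /negPf ->; rewrite csq0.
transitivity (\sum_(x | tyr x == r) csq (a x 0) / pr r); last first.
  rewrite -mulr_suml -/(pr r); have [->|p0] := eqVneq (pr r) 0.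
    by rewrite mul0r.
  by rewrite divff.
apply: eq_bigr => x /eqP xr; rewrite xr eqxx tr /= -fmorphV csqM csqR exprVn.
by rewrite sqr_sqrtr // pr_ge0.
Qed.

Lemma prep_mx_supp : prep_mx *m rdiag supp = prep_mx.
Proof.
apply/matrixP => x k; rewrite mul_rdiagE mxE [supp 0 k]mxE.
case: (mxtens_indexP k) => c r; rewrite mxtens_indexK /=.
case: (c == 0); rewrite ?mul0r //=.
have [<-|] := eqVneq (tyr x) r; rewrite ?mul0r //=.
case: (typ _); rewrite ?mul0r //=.
have [p0|] := eqVneq (pr (tyr x)) 0; last by rewrite rmorph1 mulr1.
by rewrite (pr_eq0 p0) !mul0r.
Qed.

Lemma prep_mx_zeta : prep_mx *m zeta = atyp.
Proof.
apply/colP => x; rewrite [RHS]mxE mxE (bigD1 (mxtens_index (0, tyr x))) //=.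
rewrite big1 ?addr0 => [|k].
  rewrite !mxE mxtens_indexK /= eqxx /=; case: (typ (tyr x)); last by rewrite mul0r.
  have [p0|p0] := eqVneq (pr (tyr x)) 0; first by rewrite (pr_eq0 p0) !mul0r.
  rewrite divfK //; apply/eqP => /complexI/eqP; rewrite sqrtr_eq0.
  by rewrite le_eqVlt (negPf p0) ltNge pr_ge0.
move=> kne; have [->|/prep_mx_neq0 e] := eqVneq (prep_mx x k) 0; first by rewrite mul0r.
by rewrite e eqxx in kne.
Qed.

Lemma supp_zeta : rdiag supp *m zeta = zeta.
Proof.
apply/colP => k; rewrite rdiag_mulE [supp 0 k]mxE mxE.
case: (mxtens_indexP k) => c r; rewrite mxtens_indexK /=.
case: (c == 0); rewrite ?mulr0 //=.
case: (typ r); rewrite ?mulr0 //=.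
have [->|] := eqVneq (pr r) 0; last by rewrite rmorph1 mul1r.
by rewrite sqrtr0 mulr0.
Qed.

Lemma zeta_outer : zeta *m adj zeta = @ket0 R *t (refvec *m adj refvec).
Proof.
apply/matrixP => k k'; rewrite mxE big_ord1 adjE.
case: (mxtens_indexP k) => c r; case: (mxtens_indexP k') => c' r'.
rewrite tensmxE [in RHS]mxE [X in _ = _ * X]mxE big_ord1 adjE !mxE !mxtens_indexK /=.
case: (c == 0); case: (c' == 0); rewrite ?mul1r ?mul0r ?rmorph0 ?mulr0 //.
Qed.

Lemma nsq_zeta : nsq zeta = nsq atyp.
Proof.
apply: complexI; rewrite -!nsqE -prep_mx_zeta adjM mulmxA -[_ *m adj _ *m _]mulmxA.
by rewrite prep_mx_gram -mulmxA supp_zeta.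
Qed.

Lemma nsq_refvec : nsq refvec = nsq atyp.
Proof.
rewrite -nsq_zeta /nsq [RHS]sum_mxtens big_ord_recl [X in _ = _ + X]big1 ?addr0.
  by apply: eq_bigr => r _; rewrite !mxE mxtens_indexK /=.
move=> c _; apply: big1 => r _; rewrite !mxE mxtens_indexK /=.
by rewrite /csq /= expr0n addr0.
Qed.

Lemma nsq_atypB : nsq (a - atyp) = \sum_(x | ~~ typ (tyr x)) csq (a x 0).
Proof.
rewrite /nsq [RHS]big_mkcond; apply: eq_bigr => x _; rewrite !mxE.
case: (typ _); rewrite /= ?subrr ?subr0 //.
by rewrite /csq /= expr0n addr0.
Qed.

Lemma nsq_atyp_split : nsq atyp + nsq (a - atyp) = 1.
Proof.
rewrite nsq_atypB -(ps_norm ps) /nsq [RHS](bigID (fun x => typ (tyr x))) /=.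
congr (_ + _); rewrite [RHS]big_mkcond; apply: eq_bigr => x _; rewrite mxE.
by case: (typ _); rewrite // /csq /= expr0n addr0.
Qed.

Lemma typ_psh x : typ (tyr x) = (`|psh ps 0 x - n%:R * mu| <= win).
Proof. by rewrite /typ /tyr enum_rankK /typical /type_energy -ps_type. Qed.

Lemma nsq_atypB_le : 0 < win -> nsq (a - atyp) <= n%:R * var / win ^+ 2.
Proof.
move=> win0; rewrite nsq_atypB -(ps_var ps).
under eq_bigl do rewrite typ_psh.
by apply: (weight_outside_le (w := fun x => csq (a x 0))) => // x; exact: csq_ge0.
Qed.

(** Solves the energy balance [ln (m - 1) / beta = (n mu - win) + eR 0 r0 + F]: flipping the qubit
    from 0 to 1 pays for raising the typical levels by [n mu - win], for leaving the reference in
    [r0] and for the extra cost [F] of a letter in the bath. *)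
Definition prep_dim : R :=
  1 + Z ^+ n * expR (beta * (n%:R * mu - win + eR 0 r0)).

Local Notation m := prep_dim.

Lemma prep_dim_gt1 : 0 < Z -> 1 < m.
Proof. by move=> Z0; rewrite ltrDl mulr_gt0 ?exprn_gt0 ?expR_gt0. Qed.

(** Three errors add up: the parameter [lam] of [csq_diff], the weight outside the window, bounded
    by Chebyshev, and the bath failure [1 / (K + 1)]. The last counts twice, once for the missing
    target and once for the residue. *)
Lemma conv_dist_le (lam : R) (K : nat) :
  0 < beta -> 0 < Z -> (forall i, 0 <= h 0 i) -> 0 < win -> 0 < lam ->
  (@conv_dist R beta (qubit beta m) (ref_system h mu win n) (sys_pow A n)
     (@ket0 R) (tpow psi n) <=
   (2^-1 * (lam + (2 + lam^-1) * (n%:R * var / win ^+ 2) + 2 * K.+1%:R^-1))%:E)%E.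
Proof.
move=> b0 Z0 h0 win0 lam0.
pose Rs := ref_system h mu win n; pose P := sys_prod (qubit beta m) Rs.
pose B := sys_pow A n; pose hB := psh ps; pose U := psU ps.
pose qe := qubit_energy beta m.
pose eP : 'rV[R]_(sdim P) := \row_k (qe 0 (mxtens_unindex k).1 + eR 0 (mxtens_unindex k).2).
have eR0 i : 0 <= eR 0 i by case/andP: (ref_energy_bound h mu i (ltW win0)).
have eP0 i : 0 <= eP 0 i by rewrite mxE addr_ge0 ?qubit_energy_ge0.
have hB0 i : 0 <= hB 0 i.
  by rewrite /hB ps_type sumr_ge0 // => j _; rewrite mulr_ge0 ?ler0n.
have shP : sham P = rdiag eP.
  rewrite /eP -rdiag_tens_sum /P /=; congr (_ *t _ + _ *t _); congr diag_mx.
  by apply/rowP => i; rewrite !mxE.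
have [UU UU'] := psU_unitary ps; have shB := ps_sham ps; rewrite -/U -/hB in UU UU' shB.
have Zn0 : 0 < Z ^+ n by rewrite exprn_gt0.
(* With this [F] the letter weights [e^{-beta (h + F)}] sum to 1, as the bath requires. *)
pose F := ln (Z ^+ n) / beta.
have norm1 : \sum_b expR (- beta * (hB 0 b + F)) = 1.
  under eq_bigr do rewrite mulrDr expRD.
  rewrite -mulr_suml (ps_Z ps) /F mulNr mulrCA divff ?gt_eqF // mulr1.
  by rewrite expRN lnK ?posrE // divff ?gt_eqF.
have [dS [eS [w [eS0 wI wE all0 goodE]]]] := bath_exists K norm1.
pose T : 'M[C]_(sdim B, sdim P) := U *m prep_mx.
(* [T] takes [|0>|t>], of energy [qe 0 0 + E(t) - (n mu - win)], to a vector of energy [E(t)]; [g]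
   is the difference. *)
pose g := n%:R * mu - win - qe 0 0.
pose p1 : 'I_(sdim P) := mxtens_index (1 : 'I_2, r0).
have TT : adj T *m T = rdiag supp.
  by rewrite /T adjM mulmxA -[_ *m adj U *m U]mulmxA UU mulmx1 prep_mx_gram.
have TTT : T *m adj T *m T = T by rewrite -mulmxA TT /T -mulmxA prep_mx_supp.
have TH : sham B *m T = T *m sham P + g%:C%C *: T.
  rewrite shP [sham B]shB /T mulmxA -[_ *m adj U *m U]mulmxA UU mulmx1 -!mulmxA.
  rewrite scalemxAr -mulmxDr; congr (_ *m _); apply/matrixP => x k.
  rewrite rdiag_mulE [in RHS]mxE mul_rdiagE [X in _ = _ + X]mxE mulrC.
  rewrite [g%:C%C * _]mulrC -mulrDr -rmorphD mxE; case: ifP => [|_]; last by rewrite !mul0r.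
  case: (mxtens_indexP k) => c r; rewrite mxtens_indexK /= => /and3P[/eqP -> /eqP <- tx].
  congr (_ * (_%:C%C)); rewrite [eP 0 _]mxE mxtens_indexK [eR 0 _]mxE -/(typ _) tx.
  by rewrite /tyr enum_rankK /type_energy -ps_type /g /hB; ring.
have Tp1 b : T b p1 = 0.
  by rewrite mxE big1 // => x _; rewrite [X in _ * X]mxE mxtens_indexK /= mulr0.
have wE' b s t : w b s = Some t -> eP 0 p1 + eS 0 t = hB 0 b + eS 0 s - g.
  move=> /wE ->; rewrite mxE mxtens_indexK /= /g.
  have := qubit_energy_gap beta m; rewrite -/qe.
  have -> : ln (m - 1) / beta = n%:R * mu - win + eR 0 r0 + F.
    rewrite /prep_dim addrAC subrr add0r lnM ?posrE ?expR_gt0 // expRK /F.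
    by field; rewrite gt_eqF.
  move=> gap; have -> : qe 0 0 = qe 0 1 + (n%:R * mu - win + eR 0 r0 + F).
    by rewrite -gap; ring.
  by ring.
have [f [thf fE]] := thermal_op_prepare_diag (beta := beta) (P := P) (B := B)
  eP0 hB0 eS0 shP (psU_unitary ps) shB TTT TH Tp1 wI wE' all0.
rewrite goodE in fE.
set gam := 1 - _ in fE.
pose q := nsq atyp.
have q1 : q <= 1 by rewrite -nsq_atyp_split lerDl nsq_ge0.
have q0 : 0 <= q := nsq_ge0 _.
pose e0 : 'cV[C]_dR := delta_mx r0 0.
have e01 : nsq e0 = 1.
  rewrite /nsq (bigD1 r0) //= big1 ?addr0; last first.
    by move=> j /negPf ji; rewrite mxE ji /csq /= expr0n addr0.
  by rewrite mxE !eqxx csqR expr1n.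
(* The truncated vector may have norm below 1, so the missing trace is put on level [r0]. What
   becomes of it is part of the residue [N]. *)
pose om2 := (1 - q)%:C%C *: (e0 *m adj e0).
have pom2 : psd om2 by apply: psdZ; [rewrite subr_ge0 | exact: psd_gram].
pose om := refvec *m adj refvec + om2.
have dom : density om.
  split; first exact: psdD (psd_gram _) pom2.
  rewrite mxtraceD mxtraceZ !tr_outer nsq_refvec e01 -/q rmorph1 mulr1 -rmorphD.
  by rewrite addrC subrK.
have k0E : @ket0 R = delta_mx 0 (0 : 'I_1) *m adj (delta_mx 0 (0 : 'I_1)).
  apply/matrixP => i j; rewrite !mxE big_ord1 adjE !mxE.
  by case: (i == 0); case: (j == 0); rewrite ?rmorph1 ?rmorph0 ?mulr1 ?mulr0.
have pk0 : psd (@ket0 R) by rewrite k0E; exact: psd_gram.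
pose Y : 'M[C]_(sdim P) := @ket0 R *t om2.
pose X : 'M[C]_(sdim P) := zeta *m adj zeta.
have pX : psd X := psd_gram _.
have pY : psd Y := psd_tens pk0 pom2.
have TX : adj T *m T *m X = X by rewrite TT /X mulmxA supp_zeta.
have [N [pN fN trN]] := fE X Y pX pY TX.
have rhoE : @ket0 R *t om = X + Y by rewrite /om tensmxDr -zeta_outer.
have trk0 : \tr (@ket0 R) = 1.
  by rewrite k0E tr_outer /nsq big_ord_recl big_ord1 !mxE /= /csq /= expr1n !expr0n /= !addr0.
have trX : \tr X = q%:C%C by rewrite /X tr_outer nsq_zeta.
have trY : \tr Y = (1 - q)%:C%C.
  rewrite /Y [LHS]tr_tens trk0 mul1r mxtraceZ tr_outer e01 rmorph1 mulr1 //.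
have trN' : \tr N = (1 - gam * q)%:C%C.
  rewrite trN trX trY -rmorphD -rmorphM -rmorphB; congr (_%:C%C); ring.
have gam1 : gam <= 1 by rewrite gerBl invr_ge0 ler0n.
apply: ereal_inf_le; exists (2^-1 * tnorm (tpow psi n - f (@ket0 R *t om)))%:E; last first.
  rewrite lee_fin ler_wpM2l ?invr_ge0 // rhoE fN (ps_tpow ps).
  have -> : T *m X *m adj T = (U *m atyp) *m adj (U *m atyp).
    have -> : U *m atyp = T *m zeta by rewrite /T -mulmxA prep_mx_zeta.
    by rewrite /X [adj (T *m zeta)]adjM !mulmxA.
  apply: le_trans (tnorm_pure_le _ _ pN trN' lam0 gam1) _.
  rewrite -mulmxBr !nsq_isom // -/q.
  have dl := nsq_atypB_le win0.
  have dq : nsq (a - atyp) = 1 - q by rewrite -nsq_atyp_split /q; ring.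
  rewrite dq in dl *; set D := n%:R * var / win ^+ 2 in dl *.
  have ge1 : gam = 1 - K.+1%:R^-1 by [].
  have K0 : 0 <= (K.+1%:R^-1 : R) by rewrite invr_ge0 ler0n.
  rewrite ge1; set k := K.+1%:R^-1 in K0 *.
  have l1 : 0 <= lam^-1 by rewrite invr_ge0 ltW.
  have i1 : lam * q <= lam by rewrite ler_piMr // ltW.
  have i2 : (2 + lam^-1) * (1 - q) <= (2 + lam^-1) * D.
    by rewrite ler_wpM2l // addr_ge0.
  have i3 : k * q <= k by rewrite ler_piMr.
  have -> : lam * q + (1 + lam^-1) * (1 - q) + (1 - (1 - k)) * q + (1 - (1 - k) * q) =
    lam * q + (2 + lam^-1) * (1 - q) + 2 * (k * q) by ring.
  clear - i1 i2 i3; lra.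
exists om, f; split=> //.
exists (fun _ => f); split=> // rho i j e e_gt0; exists 0%N => k _.
by rewrite subrr normr0 ltcE /= eqxx e_gt0.
Qed.

End OneShot.

(** * Rates *)

Section Asymptotics.
Context {R : realType}.
Local Notation C := R[i].

Lemma limn_einf_eq_sup (u : (\bar R)^nat) : limn_einf u = ereal_sup (range (einfs u)).
Proof. by rewrite limn_einf_lim; apply: cvg_lim => //; exact: cvg_einfs_sup. Qed.

Lemma limn_einf_ge (u : (\bar R)^nat) (l : \bar R) N :
  (forall n, (N <= n)%N -> (l <= u n)%E) -> (l <= limn_einf u)%E.
Proof.
move=> h; rewrite limn_einf_eq_sup; apply: le_trans (ereal_sup_ubound _); last first.
  by exists N.
by apply: le_ereal_inf_tmp => _ [n /= Nn <-]; exact: h.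
Qed.

Lemma limn_einf_le (u : (\bar R)^nat) (l : \bar R) N :
  (forall n, (N <= n)%N -> (u n <= l)%E) -> (limn_einf u <= l)%E.
Proof.
move=> h; rewrite limn_einf_eq_sup; apply: ge_ereal_sup => _ [k _ <-].
apply: (@le_trans _ _ (u (maxn k N))); last exact: h (leq_maxr _ _).
by apply: ereal_inf_lbound; exists (maxn k N) => //=; exact: leq_maxl.
Qed.

Lemma ln2_gt0 : 0 < ln (2 : R).
Proof. by rewrite ln_gt0 // ltr1n. Qed.

Lemma elog2_ge (x : \bar R) (r : R) : 0 < r -> (r%:E <= x)%E ->
  ((ln r / ln 2)%:E <= elog2 x)%E.
Proof.
move=> r0; case: x => [y| |] //=; rewrite ?leey // !lee_fin => ry.
rewrite ler_wpM2r ?invr_ge0 ?ln_ge0 ?ler1n // ler_ln ?posrE //.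
exact: lt_le_trans ry.
Qed.

Lemma elog2_le (x : \bar R) (r : R) : (1%:E <= x)%E -> (x <= r%:E)%E ->
  (elog2 x <= (ln r / ln 2)%:E)%E.
Proof.
case: x => [y| |] //=; rewrite !lee_fin => y1 yr.
have y0 : 0 < y by exact: lt_le_trans y1.
rewrite ler_wpM2r ?invr_ge0 ?ln_ge0 ?ler1n // ler_ln ?posrE //.
exact: lt_le_trans yr.
Qed.

Lemma powR_le_linear (alpha eta : R) : alpha < 1 -> 0 < eta ->
  exists N, forall n, (N < n)%N -> n%:R `^ alpha <= eta * n%:R.
Proof.
move=> a1 eta0; pose y := (eta^-1) `^ (1 - alpha)^-1.
have a0 : 0 < 1 - alpha by rewrite subr_gt0.
exists (Num.truncn y) => n yn.
have n0 : 0 < n%:R :> R by rewrite ltr0n (leq_ltn_trans _ yn).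
have yn' : y <= n%:R.
  have := real_truncnS_gt (num_real y); move/ltW => /le_trans; apply.
  by rewrite ler_nat.
have h : eta^-1 <= n%:R `^ (1 - alpha).
  have -> : eta^-1 = y `^ (1 - alpha).
    by rewrite /y -powRrM mulVf ?gt_eqF // powRr1 // invr_ge0 ltW.
  by rewrite ge0_ler_powR ?nnegrE ?powR_ge0 // ?(ltW a0) // ltW.
have e : n%:R `^ alpha * n%:R `^ (1 - alpha) = n%:R :> R.
  rewrite -powRD; last by rewrite (gt_eqF n0) implybT.
  by rewrite addrC subrK powRr1 // ltW.
rewrite [leRHS](_ : _ = n%:R `^ alpha * (eta * n%:R `^ (1 - alpha))); last first.
  by rewrite mulrCA e.
by rewrite ler_peMr ?powR_ge0 // -ler_pdivrMl // mulr1.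
Qed.

(** [ln n = 2 ln (sqrt n) <= 2 sqrt n], and the square root is sublinear by [powR_le_linear]. *)
Lemma ln_le_linear (eta : R) : 0 < eta ->
  exists N, forall n, (N < n)%N -> ln n%:R <= eta * n%:R.
Proof.
move=> eta0; have a1 : 2^-1 < 1 :> R by rewrite invf_lt1 // ltr1n.
have e2 : 0 < eta / 2 by rewrite divr_gt0.
have [N hN] := powR_le_linear a1 e2.
exists N => n Nn; have n0 : 0 < n%:R :> R by rewrite ltr0n (leq_ltn_trans _ Nn).
have s0 : 0 < Num.sqrt n%:R :> R by rewrite sqrtr_gt0.
have -> : ln n%:R = ln (Num.sqrt n%:R) *+ 2 :> R.
  by rewrite -lnXn // sqr_sqrtr // ltW.
have i1 := hN n Nn; rewrite powR12_sqrt ?(ltW n0) // in i1.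
have i2 : ln (Num.sqrt n%:R) <= Num.sqrt n%:R :> R.
  have := @le_ln1Dx R (Num.sqrt n%:R - 1); rewrite addrCA subrr addr0 => h.
  by rewrite (le_trans (h _)) ?gerBl // ltrBrDr addNr.
rewrite [eta * _](_ : _ = eta / 2 * n%:R + eta / 2 * n%:R); last by field.
by rewrite mulr2n lerD // (le_trans i2).
Qed.

Lemma const_le_linear (c eta : R) : 0 < eta ->
  exists N, forall n, (N < n)%N -> c <= eta * n%:R.
Proof.
move=> eta0; exists (Num.truncn (c / eta)) => n Nn.
rewrite mulrC -ler_pdivrMr //.
have := real_truncnS_gt (num_real (c / eta)); move/ltW => /le_trans; apply.
by rewrite ler_nat.
Qed.

Lemma sublinear_bound (b c C alpha eta : R) (k : nat) : 0 <= b -> alpha < 1 -> 0 < eta ->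
  0 < C -> exists N, forall n, (N < n)%N ->
    b * n%:R `^ alpha + ln (C * n%:R ^+ k) + c <= eta * n%:R.
Proof.
move=> b0 a1 eta0 C0.
(* Each of the three contributions gets a third of [eta]; [b + 1] and [k.+1] avoid dividing by 0. *)
have e1 : 0 < eta / 3 / (b + 1) by rewrite !divr_gt0 // ltr_wpDl.
have e2 : 0 < eta / 3 / k.+1%:R by rewrite !divr_gt0 // ltr0n.
have e3 : 0 < eta / 3 by rewrite divr_gt0.
have [N1 h1] := powR_le_linear a1 e1.
have [N2 h2] := ln_le_linear e2.
have [N3 h3] := const_le_linear (ln C + c) e3.
exists (maxn N1 (maxn N2 N3)) => n; rewrite !gtn_max => /and3P[n1 n2 n3].
have n0 : 0 < n%:R :> R by rewrite ltr0n (leq_ltn_trans _ n1).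
rewrite lnM ?posrE ?exprn_gt0 // lnXn // -[ln n%:R *+ k]mulr_natl.
have i1 : b * n%:R `^ alpha <= eta / 3 * n%:R.
  apply: (@le_trans _ _ ((b + 1) * n%:R `^ alpha)).
    by rewrite ler_wpM2r ?powR_ge0 // lerDl.
  rewrite mulrC -ler_pdivlMr ?ltr_wpDl // mulrAC; exact: h1.
have i2 : k%:R * ln n%:R <= eta / 3 * n%:R.
  apply: (@le_trans _ _ (k.+1%:R * ln n%:R)).
    rewrite ler_wpM2r ?ler_nat // ln_ge0 // ler1n; exact: leq_ltn_trans n1.
  rewrite mulrC -ler_pdivlMr ?ltr0n // mulrAC; exact: h2.
have i3 := h3 n n3.
rewrite [eta * _](_ : _ = eta / 3 * n%:R + eta / 3 * n%:R + eta / 3 * n%:R); last by field.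
move: (eta / 3 * n%:R) i1 i2 i3 => z i1 i2 i3; lra.
Qed.

End Asymptotics.

(** * Relative entropy of a pure state to the Gibbs state *)

Section RelativeEntropy.
Context {R : realType} (beta : R).
Local Notation C := R[i].

(** The eigenvalues are 0 and 1, and [lg] vanishes at both: at 1 because [ln 1 = 0], at 0 by
    convention. *)
Lemma fcalc_lg_proj n (P : 'M[C]_n) : hermitian P -> P *m P = P -> fcalc (@lg R) P = 0.
Proof.
move=> hP PP; have [U [d [[UU UU'] eP]]] := hermitian_spectral hP.
rewrite (fcalcE _ UU UU' eP).
suff -> : map_mx (@lg R) d = 0 *: d by rewrite rdiagZ rmorph0 scale0r mulmx0 mul0mx.
apply/rowP => i; rewrite !mxE mul0r.
have dd : rdiag d *m rdiag d = rdiag d.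
  have rdE : rdiag d = adj U *m P *m U by rewrite eP !mulmxA UU mul1mx -mulmxA UU mulmx1.
  by rewrite {1 2}rdE !mulmxA -[_ *m U *m adj U]mulmxA UU' mulmx1 -[_ *m P *m P]mulmxA PP rdE.
move/matrixP/(_ i i): dd; rewrite rdiagM !rdiagE eqxx mxE => /complexI/eqP.
rewrite -subr_eq0 -{3}[d 0 i]mulr1 -mulrBr mulf_eq0 subr_eq0 => /orP[] /eqP ->.
  by rewrite /lg ltxx.
by rewrite /lg ltr01 ln1 mul0r.
Qed.

(** The entropy term vanishes since [psi] is a projection, and [ln gamma = - beta H - ln Z]. *)
Lemma relent_pureE (A : system R) (U : 'M[C]_(sdim A)) (h : 'rV[R]_(sdim A))
    (a : 'cV[C]_(sdim A)) (Z := \sum_i expR (- beta * h 0 i)) :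
  unitary U -> sham A = U *m rdiag h *m adj U -> (forall i, 0 <= h 0 i) ->
  nsq a = 1 -> 0 < Z ->
  relent ((U *m a) *m adj (U *m a)) (gibbs beta A) =
  (beta * (\sum_i csq (a i 0) * h 0 i) + ln Z) / ln 2.
Proof.
move=> [UU UU'] eA h0 na Z0; set psi := _ *m _.
have a1 : adj (U *m a) *m (U *m a) = 1%:M.
  apply/matrixP => i j; rewrite !ord1 nsqE nsq_isom // na mxE eqxx //.
have psi2 : psi *m psi = psi.
  by rewrite /psi mulmxA -[_ *m adj _ *m _]mulmxA a1 mulmx1.
have hpsi : hermitian psi by rewrite /hermitian /psi adjM adjK.
rewrite /relent fcalc_lg_proj // mulmx0 mxtrace0 sub0r.
have vA : valid_sys A by rewrite /valid_sys eA; exact: psd_rdiag.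
have gE : gibbs beta A = U *m rdiag (\row_i (Z^-1 * expR (- beta * h 0 i))) *m adj U.
  rewrite gibbsE // (partition_funE beta UU UU' eA) (expHE beta UU UU' eA).
  rewrite scalemxAl scalemxAr -rdiagZ; congr (_ *m rdiag _ *m _).
  by apply/rowP => i; rewrite !mxE.
rewrite (fcalcE _ UU UU' gE).
set l := map_mx _ _.
have -> : \tr (psi *m (U *m rdiag l *m adj U)) = (adj a *m rdiag l *m a) 0 0.
  rewrite /psi -mulmxA mxtrace_mulC [LHS]big_ord1; congr (_ 0 0).
  rewrite adjM !mulmxA -[_ *m adj U *m U]mulmxA UU mulmx1.
  by rewrite -[_ *m adj U *m U]mulmxA UU mulmx1.
rewrite quad_rdiag -rmorphN /= -sumrN.
have lnZE : ln Z = \sum_i csq (a i 0) * ln Z by rewrite -mulr_suml -/(nsq a) na mul1r.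
rewrite lnZE mulr_sumr -big_split mulr_suml; apply: eq_bigr => i _ /=.
rewrite !mxE /lg mulr_gt0 ?invr_gt0 ?expR_gt0 // lnM ?posrE ?invr_gt0 ?expR_gt0 //.
rewrite lnV ?posrE // expRK; ring.
Qed.

(** Nonnegativity of the relative entropy, from [e^x >= 1 + x] and [p_i <= 1]: [e^{beta mu} Z] is at
    least the sum of [p_i (1 + beta (mu - h_i))], which is 1. It keeps the summand 1 of [prep_dim]
    harmless. *)
Lemma free_energy_ge0 d (h : 'rV[R]_d) (a : 'cV[C]_d) (Z := \sum_i expR (- beta * h 0 i)) :
  nsq a = 1 -> 0 <= beta * (\sum_i csq (a i 0) * h 0 i) + ln Z.
Proof.
move=> na; set mu := \sum_i csq _ * _.
have p1 i : csq (a i 0) <= 1.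
  by rewrite -na /nsq (bigD1 i) //= lerDl sumr_ge0 // => j _; exact: csq_ge0.
have key : 1 <= expR (beta * mu) * Z.
  rewrite mulr_sumr.
  apply: (@le_trans _ _ (\sum_i csq (a i 0) * (1 + (beta * mu + - beta * h 0 i)))).
    rewrite (_ : \sum_i _ = \sum_i (csq (a i 0) * (1 + beta * mu) - beta * (csq (a i 0) * h 0 i))).
      by rewrite sumrB -mulr_suml -mulr_sumr -/(nsq a) na mul1r addrK.
    by apply: eq_bigr => i _; ring.
  apply: ler_sum => i _; rewrite -expRD.
  apply: le_trans (_ : csq (a i 0) * expR (beta * mu + - beta * h 0 i) <= _).
    by rewrite ler_wpM2l ?csq_ge0 // expR_ge1Dx.
  by rewrite ler_piMl ?expR_ge0.
have Z0 : 0 < Z.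
  have : 0 < expR (beta * mu) * Z by exact: lt_le_trans key.
  by rewrite pmulr_rgt0 ?expR_gt0.
by rewrite -[beta * mu]expRK -lnM ?posrE ?expR_gt0 // ln_ge0.
Qed.

End RelativeEntropy.

(** * Lower bound for a fixed number of copies *)

Section ConverseRate.
Context {R : realType} (beta : R) (A : system R) (psi : 'M[R[i]]_(sdim A))
  (h : 'rV[R]_(sdim A)) (Z mu var : R) (n : nat)
  (ps : pow_spectrum psi h beta Z mu var n) (win : R).
Local Notation C := R[i].
Local Notation a := (psa ps).

Let trunc : 'cV[C]_(sdim (sys_pow A n)) :=
  \col_x (if `|psh ps 0 x - n%:R * mu| <= win then a x 0 else 0).

Lemma nsq_trunc : nsq trunc = \sum_(x | `|psh ps 0 x - n%:R * mu| <= win) csq (a x 0).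
Proof.
rewrite /nsq [RHS]big_mkcond; apply: eq_bigr => x _; rewrite mxE.
by case: ifP => _; rewrite ?csq0.
Qed.

Lemma nsq_trunc_ge : 0 < win -> 1 - n%:R * var / win ^+ 2 <= nsq trunc.
Proof.
move=> win0; rewrite nsq_trunc lerBlDr -[leLHS](ps_norm ps) /nsq.
rewrite [leLHS](bigID (fun x => `|psh ps 0 x - n%:R * mu| <= win)) /= lerD2l -(ps_var ps).
by apply: (weight_outside_le (w := fun x => csq (a x 0))) => // x; exact: csq_ge0.
Qed.

Lemma nsq_trunc_le1 : nsq trunc <= 1.
Proof.
rewrite nsq_trunc -[leRHS](ps_norm ps) /nsq.
rewrite [leRHS](bigID (fun x => `|psh ps 0 x - n%:R * mu| <= win)) /=.
by rewrite lerDl sumr_ge0 // => x _; exact: csq_ge0.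
Qed.

(** The test vector is the truncation of [psi^{(x) n}] to the window. Its squared norm is at least
    3/4, so the form of the target at it is at least 9/16, above 1/2; removing the error [2 * 8^-1]
    leaves at least 1/4. *)
Lemma resource_dim_ge (Rs : system R) (m b eps : R) :
  0 < beta -> 0 < Z -> (forall i, 0 <= h 0 i) -> valid_sys Rs ->
  opnorm_le (sham Rs) b -> eps < 8^-1 -> 0 < win -> n%:R * var / win ^+ 2 <= 4^-1 ->
  1 < m ->
  (@conv_dist R beta (qubit beta m) Rs (sys_pow A n) (@ket0 R) (tpow psi n) <= eps%:E)%E ->
  4^-1 <= m * (sdim Rs)%:R * expR (beta * b) *
    ((Z ^+ n)^-1 * expR (- beta * (n%:R * mu - win))).
Proof.
move=> b0 Z0 h0 vR oR eps8 win0 cheb m1 dist.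
have [UU UU'] := psU_unitary ps; have eB := ps_sham ps.
have hB0 i : 0 <= psh ps 0 i.
  by rewrite ps_type sumr_ge0 // => j _; rewrite mulr_ge0 ?ler0n.
have vB : valid_sys (sys_pow A n) by rewrite /valid_sys eB; exact: psd_rdiag.
have ZB : partition_fun beta (sys_pow A n) = Z ^+ n.
  by rewrite (partition_funE beta UU UU' eB) (ps_Z ps).
have Zn0 : 0 < Z ^+ n by rewrite exprn_gt0.
have hs : hermitian (tpow psi n) by rewrite /hermitian (ps_tpow ps) adjM adjK.
pose v := psU ps *m trunc.
have nv : nsq v = nsq trunc by exact: nsq_isom.
have v1 : nsq v <= 1 by rewrite nv nsq_trunc_le1.
have ZB0 : 0 < partition_fun beta (sys_pow A n) by rewrite ZB.
have := conv_dist_dominated b0 m1 vR oR vB ZB0 hs v1 dist eps8.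
rewrite ZB.
have -> : complex.Re ((adj v *m tpow psi n *m v) 0 0) = nsq trunc ^+ 2.
  have ip : (adj v *m (psU ps *m a)) 0 0 = (nsq trunc)%:C%C.
    rewrite /v adjM mulmxA -[_ *m adj _ *m _]mulmxA UU mulmx1 mxE.
    rewrite rmorph_sum; apply: eq_bigr => x _; rewrite /= csqE adjE mxE.
    by case: ifP => _; rewrite ?conjc0 ?mul0r.
  have ip' : (adj (psU ps *m a) *m v) 0 0 = (nsq trunc)%:C%C.
    by rewrite -[v]adjK -adjM adjE ip conjc_real.
  rewrite (ps_tpow ps); move: (psU ps *m a) ip ip' => w ip ip'.
  rewrite [adj v *m _]mulmxA -[_ *m adj w *m v]mulmxA mxE big_ord1 ip ip'.
  by rewrite -rmorphM /= expr2.
(* On the window energies are at least [n mu - win], which bounds the Gibbs weight from above. *)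
have qle : complex.Re ((adj v *m expH beta (sys_pow A n) *m v) 0 0) <=
    expR (- beta * (n%:R * mu - win)).
  rewrite (expHE beta UU UU' eB) /v adjM.
  set d := \row_i _.
  have -> : adj trunc *m adj (psU ps) *m (psU ps *m rdiag d *m adj (psU ps)) *m (psU ps *m trunc)
      = adj trunc *m rdiag d *m trunc.
    rewrite !mulmxA -[_ *m adj _ *m psU ps]mulmxA UU mulmx1.
    by rewrite -[_ *m adj _ *m psU ps]mulmxA UU mulmx1.
  rewrite quad_rdiag /=.
  apply: (@le_trans _ _ (\sum_i expR (- beta * (n%:R * mu - win)) * csq (trunc i 0))); last first.
    by rewrite -mulr_sumr ler_piMr ?expR_ge0 // nsq_trunc_le1.
  apply: ler_sum => x _; rewrite /d mxE [trunc x 0]mxE.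
  case: ifP => [|_]; last by rewrite csq0 !mulr0.
  rewrite ler_norml => /andP[hx _]; rewrite ler_wpM2r ?csq_ge0 // ler_expR.
  by rewrite !mulNr lerN2 ler_wpM2l ?(ltW b0) // addrC -lerBrDr.
have qge := nsq_trunc_ge win0.
have q34 : 4^-1 * 3 <= nsq trunc by lra.
have q2 : 2^-1 <= nsq trunc ^+ 2 by nra.
move=> hd; have : 4^-1 <= m * (sdim Rs)%:R * expR (beta * b) *
    ((Z ^+ n)^-1 * complex.Re ((adj v *m expH beta (sys_pow A n) *m v) 0 0)).
  by clear - hd q2; lra.
move=> /le_trans; apply; rewrite ler_wpM2l //.
  by rewrite !mulr_ge0 ?expR_ge0 // ltW // (lt_trans _ m1).
by rewrite ler_wpM2l // invr_ge0 ltW.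
Qed.

End ConverseRate.

(** * Asymptotic rates over all references *)

Section Rates.
Context {R : realType} (beta : R) (A : system R) (psi : 'M[R[i]]_(sdim A))
  (h : 'rV[R]_(sdim A)) (Z mu var : R)
  (ps : forall n, pow_spectrum psi h beta Z mu var n).
Local Notation C := R[i].
Local Notation rate := (beta * mu + ln Z).

(** Logarithm of [resource_dim_ge], solved for [ln m]; [ln c] and [beta b] are the contributions of
    the dimension and the energy of the reference. *)
Lemma cost_eps_ge (Rs : system R) (n : nat) (b c eps win : R) :
  0 < beta -> 0 < Z -> (forall i, 0 <= h 0 i) -> valid_sys Rs ->
  opnorm_le (sham Rs) b -> (sdim Rs)%:R <= c -> 0 < c ->
  eps < 8^-1 -> 0 < win -> n%:R * var / win ^+ 2 <= 4^-1 ->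
  (((n%:R * rate - (beta * win + (beta * b + ln c + ln 4))) / ln 2)%:E <=
    @cost_eps R beta Rs (sys_pow A n) (tpow psi n) eps)%E.
Proof.
move=> b0 Z0 h0 vR oR dc c0 eps8 win0 cheb.
set y := n%:R * rate - _; rewrite -[y]expRK; apply: elog2_ge; first exact: expR_gt0.
apply: le_ereal_inf_tmp => _ [m [m1 dist] <-]; rewrite lee_fin.
have := resource_dim_ge (ps n) b0 Z0 h0 vR oR eps8 win0 cheb m1 dist.
have m0 : 0 < m by exact: lt_trans m1.
have Zn0 : 0 < Z ^+ n by rewrite exprn_gt0.
set G := (Z ^+ n)^-1 * _; have G0 : 0 < G by rewrite mulr_gt0 ?invr_gt0 ?expR_gt0.
move=> hq.
have hq' : 4^-1 <= m * c * expR (beta * b) * G.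
  apply: le_trans hq _; rewrite ler_wpM2r ?(ltW G0) // ler_wpM2r ?expR_ge0 //.
  by rewrite ler_wpM2l // ltW.
rewrite -[m in leRHS]lnK ?posrE // ler_expR.
have : ln 4^-1 <= ln (m * c * expR (beta * b) * G).
  have p0 : 0 < m * c * expR (beta * b) * G.
    by rewrite mulr_gt0 // mulr_gt0 ?expR_gt0 // mulr_gt0.
  by rewrite ler_ln // posrE ?invr_gt0.
rewrite lnV ?posrE // !lnM ?posrE ?mulr_gt0 ?invr_gt0 ?expR_gt0 //.
rewrite lnV ?posrE // lnXn // !expRK -[ln Z *+ n]mulr_natl /y.
have -> : - beta * (n%:R * mu - win) = beta * win - n%:R * (beta * mu) by ring.
rewrite [n%:R * (_ + _)]mulrDr.
move: (n%:R * (beta * mu)) (n%:R * ln Z) (beta * win) (beta * b) (ln c) (ln m) (ln 4).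
by clear => t1 t2 t3 t4 t5 t6 t7; lra.
Qed.

Lemma slar_rate_ge (Rn : nat -> system R) (eps : R) :
  0 < beta -> 0 < Z -> (forall i, 0 <= h 0 i) -> 0 <= var -> SLAR Rn -> eps < 8^-1 ->
  ((rate / ln 2)%:E <= limn_einf (fun n : nat => (n%:R^-1)%:E *
      @cost_eps R beta (Rn n) (sys_pow A n) (tpow psi n) eps))%E.
Proof.
move=> b0 Z0 h0 v0 [vR [[Cd [k hd]] [c [alpha [c0 a0 a1 hc]]]]] eps8.
apply/lee_subgt0Pr => eta eta0.
pose e := eta * ln 2; have e0 : 0 < e by rewrite mulr_gt0 ?ln2_gt0.
have e2 : 0 < e / 2 by rewrite divr_gt0.
(* The window [n dl] grows linearly and costs [beta n dl], half of the allowance [e n]; the other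
   half absorbs the sublinear terms. *)
pose dl := e / 2 / beta; have dl0 : 0 < dl by rewrite divr_gt0.
have bc0 : 0 <= beta * c by rewrite mulr_ge0 ?ltW.
have Cd0 : 0 < `|Cd| + 1 by rewrite ltr_wpDl.
have [N1 h1] := sublinear_bound (ln 4) k bc0 a1 e2 Cd0.
have [N2 h2] := const_le_linear (4 * var / dl ^+ 2) (ltr01 : 0 < (1 : R)).
apply: (@limn_einf_ge _ _ _ (maxn N1 N2).+1) => n; rewrite gtn_max => /andP[n1 n2].
have n0 : 0 < n%:R :> R by rewrite ltr0n (leq_ltn_trans _ n1).
have n0' : (0 < n)%N by rewrite (leq_ltn_trans _ n1).
have win0 : 0 < n%:R * dl by rewrite mulr_gt0.
have cheb : n%:R * var / (n%:R * dl) ^+ 2 <= 4^-1.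
  rewrite ler_pdivrMr ?exprn_gt0 //; have := h2 n n2; rewrite mul1r ler_pdivrMr ?exprn_gt0 //.
  move=> hh; have : n%:R * (4 * var) <= n%:R * (n%:R * dl ^+ 2) by rewrite ler_wpM2l // ltW.
  have -> : n%:R * (4 * var) = 4 * (n%:R * var) by ring.
  have -> : n%:R * (n%:R * dl ^+ 2) = (n%:R * dl) ^+ 2 by ring.
  by move=> hh2; rewrite ler_pdivlMl.
have nk0 : 0 < (`|Cd| + 1) * n%:R ^+ k by rewrite mulr_gt0 ?exprn_gt0.
have dimb : (sdim (Rn n))%:R <= (`|Cd| + 1) * n%:R ^+ k.
  apply: le_trans (hd n n0') _; rewrite ler_wpM2r ?exprn_ge0 ?ler0n //.
  by rewrite (le_trans (ler_norm _)) // lerDl.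
have := cost_eps_ge b0 Z0 h0 (vR n) (hc n n0') dimb nk0 eps8 win0 cheb.
move=> /(lee_wpmul2l (x := (n%:R^-1)%:E)) hh.
apply: le_trans (hh _); last by rewrite lee_fin invr_ge0 ler0n.
rewrite -EFinM -EFinB lee_fin.
have := h1 n n1; rewrite -mulrA.
have -> : n%:R^-1 * ((n%:R * rate - (beta * (n%:R * dl) + (beta * (c * n%:R `^ alpha) +
   ln ((`|Cd| + 1) * n%:R ^+ k) + ln 4))) / ln 2) =
  rate / ln 2 - (beta * dl + (beta * (c * n%:R `^ alpha) +
   ln ((`|Cd| + 1) * n%:R ^+ k) + ln 4) / n%:R) / ln 2.
  by field; rewrite !gt_eqF // ln2_gt0.
move: (beta * (c * _) + _ + _) => t ht.
rewrite lerD2l lerN2 ler_pdivrMr ?ln2_gt0 // -/e.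
have -> : beta * dl = e / 2 by rewrite /dl; field; rewrite gt_eqF.
have : t / n%:R <= e / 2 by rewrite ler_pdivrMr.
by move: (t / n%:R) (e / 2) (splitr e) => s u ->; rewrite lerD2l.
Qed.

Lemma cost_eps_le (Rs B : system R) (sigma : 'M[C]_(sdim B)) (m eps : R) : 1 < m ->
  (@conv_dist R beta (qubit beta m) Rs B (@ket0 R) sigma <= eps%:E)%E ->
  (@cost_eps R beta Rs B sigma eps <= (ln m / ln 2)%:E)%E.
Proof.
move=> m1 dist; apply: elog2_le.
  by apply: le_ereal_inf_tmp => _ [m' [m'1 _] <-]; rewrite lee_fin ltW.
by apply: ereal_inf_lbound; exists m.
Qed.

(** With [d] the dimension of [A], the reference has [(n + 1)^d <= (2 n)^d] levels, and its energies
    are at most [2 L sqrt n], so the exponent is 1/2. *)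
Lemma SLAR_ref (L : R) : 0 < L ->
  SLAR (fun n => ref_system h mu (L * Num.sqrt n%:R) n).
Proof.
move=> L0.
have win0 n : 0 <= L * Num.sqrt n%:R by rewrite mulr_ge0 ?sqrtr_ge0 ?ltW.
have bd n i := @ref_energy_bound _ _ n h mu _ i (win0 n).
split; [|split].
- by move=> n; apply: valid_rdiag => i; case/andP: (bd n i).
- exists (2 ^+ sdim A), (sdim A) => n n0.
  rewrite /= card_ffun !card_ord natrX -exprMn lerXn2r ?nnegrE ?mulr_ge0 ?ler0n //.
  by rewrite -natrM ler_nat mul2n -addnn -addn1 leq_add2l.
- exists (2 * L), 2^-1; split; rewrite ?mulr_gt0 ?invr_ge0 ?invf_lt1 ?ltr1n //.
  move=> n n0; rewrite powR12_sqrt ?ler0n // -mulrA.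
  by apply: opnorm_le_rdiag => [i|]; [exact: bd | rewrite mulr_ge0].
Qed.

Lemma slar_rate_le (eps : R) :
  0 < beta -> 0 < Z -> (forall i, 0 <= h 0 i) -> 0 <= var -> 0 <= rate -> 0 < eps ->
  exists2 Rn, SLAR Rn & (limn_einf (fun n : nat => (n%:R^-1)%:E *
      @cost_eps R beta (Rn n) (sys_pow A n) (tpow psi n) eps) <= (rate / ln 2)%:E)%E.
Proof.
move=> b0 Z0 h0 v0 r0 eps0.
have ei0 : 0 < eps^-1 by rewrite invr_gt0.
(* This [V] makes the Chebyshev term at most [eps / 2], and [K] below does the same for the bath
   failure. With [lam = eps] the three terms add up to at most [2 eps], which [conv_dist_le]
   halves. *)
pose V := (2 + eps^-1) * var * 2 / eps + 1.
have V0 : 0 < V by rewrite ltr_wpDl // !mulr_ge0 ?addr_ge0 // ltW.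
pose L := Num.sqrt V; have L0 : 0 < L by rewrite sqrtr_gt0.
pose K := Num.truncn (4 / eps).
exists (fun n => ref_system h mu (L * Num.sqrt n%:R) n); first exact: SLAR_ref.
apply/lee_addgt0Pr => eta eta0.
pose e := eta * ln 2; have e0 : 0 < e by rewrite mulr_gt0 ?ln2_gt0.
have bL0 : 0 <= beta * L by rewrite mulr_ge0 ?ltW.
have a1 : 2^-1 < 1 :> R by rewrite invf_lt1 // ltr1n.
have [N h1] := sublinear_bound (ln 2) 0 bL0 a1 e0 (ltr01 : 0 < (1 : R)).
apply: (@limn_einf_le _ _ _ N.+1) => n Nn.
have n0' : (0 < n)%N by rewrite (leq_ltn_trans _ Nn).
have n0 : 0 < n%:R :> R by rewrite ltr0n.
have s0 : 0 < Num.sqrt n%:R :> R by rewrite sqrtr_gt0.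
pose win := L * Num.sqrt n%:R; have win0 : 0 < win by rewrite mulr_gt0.
pose m := prep_dim beta h Z mu n win.
have m1 : 1 < m by exact: prep_dim_gt1.
have dist := conv_dist_le (ps n) K b0 Z0 h0 win0 eps0; rewrite -/m in dist.
have wE : n%:R * var / win ^+ 2 = var / V.
  rewrite /win exprMn !sqr_sqrtr ?(ltW n0) ?(ltW V0) //.
  by field; rewrite !gt_eqF.
have b1 : (2 + eps^-1) * (n%:R * var / win ^+ 2) <= eps / 2.
  rewrite wE mulrA ler_pdivrMr // /V mulrDr mulr1.
  rewrite [X in _ <= X + _](_ : _ = (2 + eps^-1) * var); last by field; rewrite gt_eqF.
  by rewrite lerDl divr_ge0 // ltW.
have b2 : 2 * K.+1%:R^-1 <= eps / 2.
  rewrite ler_pdivrMr ?ltr0n // mulrAC ler_pdivlMr //.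
  have := real_truncnS_gt (num_real (4 / eps)); rewrite -/K ltr_pdivrMr // mulrC.
  by move=> /ltW; apply: le_trans; rewrite -natrM.
have dist' : (@conv_dist R beta (qubit beta m) (ref_system h mu win n) (sys_pow A n)
     (@ket0 R) (tpow psi n) <= eps%:E)%E.
  apply: le_trans dist _; rewrite lee_fin ler_pdivrMl //.
  rewrite [leRHS](_ : _ = eps + eps / 2 + eps / 2); last by field.
  by rewrite !lerD.
have /(lee_wpmul2l (x := (n%:R^-1)%:E)) hh := cost_eps_le m1 dist'.
apply: le_trans (hh _) _; first by rewrite lee_fin invr_ge0 ler0n.
rewrite -EFinM -EFinD lee_fin.
(* Since [rate >= 0], both summands of [prep_dim] are at most [e^{n rate + beta win}]; their sum
   costs a factor 2. *)
have lnm : ln m <= ln 2 + (n%:R * rate + beta * win).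
  have y0 : 0 <= n%:R * rate + beta * win by rewrite addr_ge0 ?mulr_ge0 ?ler0n // ltW.
  rewrite -[X in ln 2 + X]expRK -lnM ?posrE ?expR_gt0 // ler_ln ?posrE; last first.
  - by rewrite mulr_gt0 ?expR_gt0.
  - exact: lt_trans m1.
  rewrite mulr_natl mulr2n /m /prep_dim lerD //; first by rewrite -[leLHS]expR0 ler_expR.
  have -> : Z ^+ n = expR (n%:R * ln Z).
    by rewrite mulr_natl -lnXn // lnK // posrE exprn_gt0.
  rewrite -expRD ler_expR.
  have /andP[_ ] := ref_energy_bound (n := n) h mu (enum_rank [ffun=> ord0]) (ltW win0).
  move: (ref_energy _ _ _ _ _ _) => t ht.
  have : beta * (n%:R * mu - win + t) <= beta * (n%:R * mu + win).
    by rewrite ler_wpM2l ?(ltW b0) // -addrA lerD2l addrC lerBlDr -mulr2n -mulr_natl.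
  have -> : n%:R * rate + beta * win = n%:R * ln Z + beta * (n%:R * mu + win) by ring.
  by rewrite lerD2l.
have := h1 n Nn; rewrite powR12_sqrt ?ler0n // expr0 mulr1 ln1 addr0 -mulrA -/win => h1'.
have -> : rate / ln 2 + eta = (n%:R^-1 * ((n%:R * rate + e * n%:R) / ln 2)).
  by rewrite /e; field; rewrite !gt_eqF // ln2_gt0.
rewrite ler_wpM2l ?invr_ge0 ?ler0n // ler_wpM2r ?invr_ge0 ?(ltW ln2_gt0) //.
apply: le_trans lnm _; rewrite addrCA lerD2l addrC //.
Qed.

End Rates.

Theorem theorem8 (R : realType) (beta : R) (A : system R) (psi : 'M[R[i]]_(sdim A)) :
  0 < beta -> valid_sys A -> pure_state psi ->
  @slar_cost R beta A psi eps @[eps --> 0^'+] --> (relent psi (gibbs beta A))%:E.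
Proof.
move=> b0 vA [v [v1 ->]].
have [U [h [[UU UU'] eA h0]]] := psd_spectral vA.
pose a := adj U *m v; have va : v = U *m a by rewrite /a mulmxA UU' mul1mx.
have na : nsq a = 1.
  rewrite nsq_isom ?adjK //; apply: complexI; rewrite -nsqE v1 mxE eqxx //.
(* A unit vector exists, so [A] has positive dimension and [Z > 0]. *)
have Z0 : 0 < \sum_i expR (- beta * h 0 i).
  have [d0|d0] := posnP (sdim A).
    have : nsq a = 0 by rewrite /nsq big1 // => i; have := ltn_ord i; rewrite {2}d0.
    by move=> a0; have := oner_neq0 R; rewrite -na a0 eqxx.
  rewrite (bigD1 (Ordinal d0)) //=; apply: ltr_pwDl; first exact: expR_gt0.
  by apply: sumr_ge0 => i _; exact: expR_ge0.
rewrite va (@relent_pureE _ beta A U h a) //.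
have ps n := @pow_spectrumP _ A U h a beta n (conj UU UU') eA na.
have r0 := free_energy_ge0 beta h na.
have var0 : 0 <= \sum_i csq (a i 0) * (h 0 i - \sum_j csq (a j 0) * h 0 j) ^+ 2.
  by apply: sumr_ge0 => i _; rewrite mulr_ge0 ?csq_ge0 ?sqr_ge0.
(* The two bounds make [slar_cost] constant for [0 < eps < 1/8], so the limit is that of an
   eventually constant function. *)
apply: cvg_near_cst; near=> eps.
have eps0 : 0 < eps by near: eps; exact: nbhs_right_gt.
have eps8 : eps < 8^-1 by near: eps; apply: nbhs_right_lt; rewrite invr_gt0.
apply/eqP; rewrite eq_le; apply/andP; split.
  have [Rn sR hR] := slar_rate_le ps b0 Z0 h0 var0 r0 eps0.
  by apply: le_trans hR; apply: ereal_inf_lbound; exists Rn.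
apply: le_ereal_inf_tmp => _ [Rn sR <-].
have hh := slar_rate_ge ps b0 Z0 h0 var0 sR eps8; exact: hh.
Unshelve. all: by end_near. Qed.
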